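(* Let $K$ be an imaginary quadratic field of discriminant $d_K$, let $\mathfrak{n}$ be a nontrivial (nonzero) ideal of $\mathcal{O}_K$, and let $N$ be the least positive integer in $\mathfrak{n}$. Then the canonical map $$\phi_\mathfrak{n}:\mathcal{Q}_N(d_K)/\sim_\mathfrak{n}\;\rightarrow\;\mathcal{C}(\mathfrak{n}),\qquad [Q]\mapsto[[\omega_Q,\,1]]$$ is a well-defined bijection. Consequently the set of equivalence classes $\mathcal{Q}_N(d_K)/\sim_\mathfrak{n}$ can be regarded (via $\phi_\mathfrak{n}$) as a group isomorphic to $\mathcal{C}(\mathfrak{n})$.
   Context: $\mathcal{Q}(d_K)$ is the set of primitive positive definite binary quadratic forms $Q(x,y)=ax^2+bxy+cy^2$ with integer coefficients and discriminant $b^2-4ac=d_K$, and $\mathcal{Q}_N(d_K)=\{ax^2+bxy+cy^2\in\mathcal{Q}(d_K)\mid\gcd(N,a)=1\}$. For $Q=ax^2+bxy+cy^2\in\mathcal{Q}(d_K)$, $\omega_Q=\frac{-b+\sqrt{d_K}}{2a}$ is the zero of $Q(x,1)$ in the complex upper half-plane. For $\alpha,\beta\in K$, $[\alpha,\beta]$ denotes the lattice $\mathbb{Z}\alpha+\mathbb{Z}\beta$. The lattice $[\omega_Q,1]$ is a fractional ideal of $K$ of norm $1/a$, hence it is relatively prime to $\mathfrak{n}$ for $Q\in\mathcal{Q}_N(d_K)$. $\mathcal{C}(\mathfrak{n})=I_K(\mathfrak{n})/P_{K,1}(\mathfrak{n})$ is the ray class group of $K$ modulo $\mathfrak{n}$,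 where $I_K(\mathfrak{n})$ is the group of fractional ideals of $K$ relatively prime to $\mathfrak{n}$ and $P_{K,1}(\mathfrak{n})=\{\nu\mathcal{O}_K\mid\nu\in K^*,\ \nu\equiv^*1\pmod{\mathfrak{n}}\}$ ($\equiv^*$ is multiplicative congruence). $[\mathfrak{a}]$ denotes the class of $\mathfrak{a}$ in $\mathcal{C}(\mathfrak{n})$. The equivalence relation $\sim_\mathfrak{n}$ on $\mathcal{Q}_N(d_K)$ is defined by: $Q\sim_\mathfrak{n}Q'$ if and only if $[[\omega_Q,1]]=[[\omega_{Q'},1]]$ in $\mathcal{C}(\mathfrak{n})$. *)

(* Defs.v *)
From HB Require Import structures.
From mathcomp Require Import all_boot all_order all_algebra all_field.
From mathcomp Require Import boolp classical_sets ring.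

Set Implicit Arguments.
Unset Strict Implicit.
Unset Printing Implicit Defensive.

Import Order.TTheory GRing.Theory Num.Theory.
Local Open Scope classical_set_scope.
Local Open Scope ring_scope.

Section NumberField.

Variable K : fieldExtType rat.
Implicit Types (A B D : set K) (x y z : K).

Definition ringOfIntegers : set K := [set x | integralOver (intr : int -> K) x].

Local Notation O := ringOfIntegers.

Definition fieldTrace x : rat :=
  \tr (passmx.mxof (vbasis {:K}) (vbasis {:K}) (amull x)).

Definition isDiscriminant (d : int) : Prop :=
  exists w : (\dim {:K}).-tuple K,
    [/\ basis_of {:K} w,
        O = [set x | exists m : 'I_(\dim {:K}) -> int,
                       x = \sum_i (m i)%:~R * w`_i]
      & d%:~R = \det (\matrix_(i < \dim {:K}, j < \dim {:K})
                        fieldTrace (w`_i * w`_j))].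

Definition isSubmodule A : Prop :=
  [/\ A 0, forall x y, A x -> A y -> A (x + y)
         & forall r x, O r -> A x -> A (r * x)].

Definition nonzero A : Prop := exists2 x, A x & x != 0.

Definition isIdeal A : Prop := isSubmodule A /\ A `<=` O.

Definition isFracIdeal A : Prop :=
  [/\ isSubmodule A, nonzero A
    & exists d, [/\ O d, d != 0 & forall x, A x -> O (d * x)]].

Definition idealAdd A B : set K := [set x + y | x in A & y in B].

Definition idealMul A B : set K :=
  [set z | exists2 s : seq (K * K),
             forall p, p \in s -> A p.1 /\ B p.2
           & z = \sum_(p <- s) p.1 * p.2].

Definition idealInv A : set K := [set x | forall y, A y -> O (x * y)].

Definition principal x : set K := [set r * x | r in O].

Record integralIdeal := IntegralIdeal {
  ideal_set :> set K;
  ideal_proof : isIdeal ideal_set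
}.

Definition coprime_ideal (n : integralIdeal) B : Prop :=
  idealAdd B n = O.

(* A = B D^-1 with B and D nonzero integral ideals relatively prime to n. *)
Definition rayIdeals (n : integralIdeal) : set (set K) :=
  [set A | isFracIdeal A /\
     exists B D, [/\ isIdeal B /\ nonzero B, isIdeal D /\ nonzero D,
                     coprime_ideal n B, coprime_ideal n D
                   & idealMul A D = B]].

(* nu = alpha / beta with alpha and beta in O relatively prime to n and
   alpha = beta mod n. *)
Definition cong_star1 (n : integralIdeal) (nu : K) : Prop :=
  nu != 0 /\
  exists alpha beta,
    [/\ O alpha /\ coprime_ideal n (principal alpha),
        O beta /\ coprime_ideal n (principal beta),
        beta != 0, ideal_set n (alpha - beta)
      & nu = alpha / beta].

Definition rayPrincipal (n : integralIdeal) : set (set K) :=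
  [set principal nu | nu in cong_star1 n].

Definition isLeastPosInt (n : integralIdeal) (N : nat) : Prop :=
  [/\ (0 < N)%N, ideal_set n N%:R
    & forall m : nat, (0 < m)%N -> ideal_set n m%:R -> (N <= m)%N].

Lemma int0 : O 0. Proof. exact: integral0. Qed.
Lemma int1 : O 1. Proof. exact: integral1. Qed.
Lemma intD x y : O x -> O y -> O (x + y). Proof. exact: integral_add. Qed.
Lemma intN x : O x -> O (- x). Proof. exact: integral_opp. Qed.
Lemma intM x y : O x -> O y -> O (x * y). Proof. exact: integral_mul. Qed.
Lemma intZ (m : int) : O m%:~R. Proof. exact: integral_id. Qed.

Lemma submodule_O : isSubmodule O.
Proof. by split; [exact: int0|exact: intD|exact: intM]. Qed.

Lemma submoduleN A x : isSubmodule A -> A x -> A (- x).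
Proof. by case=> _ _ h /(h _ _ (intZ (-1))); rewrite intrN mulN1r. Qed.

Lemma idealMul_mem A B x y : A x -> B y -> idealMul A B (x * y).
Proof.
move=> Ax By; exists [:: (x, y)]; last by rewrite big_seq1.
by move=> p; rewrite inE => /eqP->.
Qed.

Lemma idealMul_min A B D : D 0 -> (forall x y, D x -> D y -> D (x + y)) ->
  (forall x y, A x -> B y -> D (x * y)) -> idealMul A B `<=` D.
Proof.
move=> D0 DD DM _ [s + ->]; elim: s => [|p s IH] h; first by rewrite big_nil.
rewrite big_cons; apply: (DD).
  by have [] := h p (mem_head _ _); apply: DM.
by apply: IH => q qs; apply: h; rewrite inE qs orbT.
Qed.

Lemma idealMul0 A B : idealMul A B 0.
Proof. by exists [::]; rewrite ?big_nil. Qed.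

Lemma idealMulD A B x y :
  idealMul A B x -> idealMul A B y -> idealMul A B (x + y).
Proof.
move=> [s hs ->] [t ht ->]; exists (s ++ t); last by rewrite big_cat.
by move=> p; rewrite mem_cat => /orP[/hs|/ht].
Qed.

Lemma idealMulC A B : idealMul A B = idealMul B A.
Proof.
by apply/seteqP; split; apply: idealMul_min;
  [exact: idealMul0|exact: idealMulD|move=> x y ? ?; rewrite mulrC;
   exact: idealMul_mem|exact: idealMul0|exact: idealMulD|
   move=> x y ? ?; rewrite mulrC; exact: idealMul_mem].
Qed.

Lemma idealMulA A B D : idealMul A (idealMul B D) = idealMul (idealMul A B) D.
Proof.
have half A1 B1 D1 :
    idealMul (idealMul A1 B1) D1 `<=` idealMul A1 (idealMul B1 D1).
  apply: idealMul_min; [exact: idealMul0|exact: idealMulD|].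
  move=> x z ABx Dz; move: x ABx.
  apply: (@idealMul_min _ _ [set x | idealMul A1 (idealMul B1 D1) (x * z)]).
  - by rewrite /= mul0r; exact: idealMul0.
  - by move=> x y /= hx hy; rewrite mulrDl; exact: idealMulD.
  - move=> x y Ax By /=; rewrite -mulrA.
    by apply: idealMul_mem => //; exact: idealMul_mem.
apply/seteqP; split; last exact: half.
rewrite (idealMulC A) (idealMulC B) (idealMulC _ D) (idealMulC A).
exact: half.
Qed.

Lemma idealMul_submodule A B : isSubmodule A -> isSubmodule (idealMul A B).
Proof.
case=> _ _ AZ; split; [exact: idealMul0|exact: idealMulD|].
move=> r x Or; move: x.
apply: (@idealMul_min _ _ [set x | idealMul A B (r * x)]).
- by rewrite /= mulr0; exact: idealMul0.
- by move=> x y /= hx hy; rewrite mulrDr; exact: idealMulD.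
- move=> x y Ax By /=; rewrite mulrA.
  by apply: idealMul_mem => //; exact: AZ.
Qed.

Lemma idealMul1 A : isSubmodule A -> idealMul O A = A.
Proof.
case=> A0 AD AZ; apply/seteqP; split.
  exact: idealMul_min.
by move=> x Ax; rewrite -[x]mul1r; apply: idealMul_mem => //; exact: int1.
Qed.

Lemma nonzero_mul A B : nonzero A -> nonzero B -> nonzero (idealMul A B).
Proof.
move=> [x Ax x0] [y By y0]; exists (x * y); last by rewrite mulf_neq0.
exact: idealMul_mem.
Qed.

Lemma ideal_mul A B : isIdeal A -> isIdeal B -> isIdeal (idealMul A B).
Proof.
move=> [Am Ai] [Bm Bi]; split; first exact: idealMul_submodule.
apply: idealMul_min; [exact: int0|exact: intD|].
by move=> x y /Ai Ox /Bi Oy; exact: intM.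
Qed.

Lemma ideal_O : isIdeal O. Proof. by split=> //; exact: submodule_O. Qed.

Lemma nonzero_O : nonzero O.
Proof. by exists 1; [exact: int1|exact: oner_neq0]. Qed.

Lemma fracIdeal_mul A B :
  isFracIdeal A -> isFracIdeal B -> isFracIdeal (idealMul A B).
Proof.
move=> [Am An [d [Od d0 Ad]]] [Bm Bn [e [Oe e0 Be]]]; split.
- exact: idealMul_submodule.
- exact: nonzero_mul.
exists (d * e); split; [exact: intM|by rewrite mulf_neq0|].
apply: (@idealMul_min _ _ [set x | O (d * e * x)]).
- by rewrite /= mulr0; exact: int0.
- by move=> x y /= hx hy; rewrite mulrDr; exact: intD.
- by move=> x y /Ad Ox /Be Oy /=; rewrite mulrACA; exact: intM.
Qed.

Lemma fracIdeal_O : isFracIdeal O.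
Proof.
split; [exact: submodule_O|exact: nonzero_O|].
exists 1; split; [exact: int1|exact: oner_neq0|by move=> x; rewrite mul1r].
Qed.

Lemma fracIdeal_inv A : isFracIdeal A -> isFracIdeal (idealInv A).
Proof.
move=> [[A0 AD AZ] [a Aa a0] [d [Od d0 Ad]]]; split.
- split.
  + by move=> y _; rewrite mul0r; exact: int0.
  + by move=> x y hx hy z Az; rewrite mulrDl; apply: intD; [exact: hx|exact: hy].
  + by move=> r x Or hx z Az; rewrite -mulrA; apply: intM => //; exact: hx.
- by exists d.
exists (d * a); split; [exact: Ad|by rewrite mulf_neq0|].
by move=> x hx; rewrite mulrC; apply: hx; exact: AZ.
Qed.

Lemma principalM x y :
  idealMul (principal x) (principal y) = principal (x * y).
Proof.
apply/seteqP; split; last first.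
  move=> _ [r Or <-]; rewrite mulrA; apply: idealMul_mem; first by exists r.
  by exists 1; [exact: int1|rewrite mul1r].
apply: idealMul_min.
- by exists 0; [exact: int0|rewrite mul0r].
- move=> _ _ [r Or <-] [s Os <-]; exists (r + s); first exact: intD.
  by rewrite mulrDl.
- move=> _ _ [r Or <-] [s Os <-]; exists (r * s); first exact: intM.
  by rewrite mulrACA.
Qed.

Lemma principal1 : principal 1 = O.
Proof.
apply/seteqP; split; first by move=> _ [r Or <-]; rewrite mulr1.
by move=> r Or; exists r; rewrite ?mulr1.
Qed.

Lemma ideal_principal x : O x -> isIdeal (principal x).
Proof.
move=> Ox; split; last by move=> _ [r Or <-]; exact: intM.
split.
- by exists 0; [exact: int0|rewrite mul0r].
- move=> _ _ [r Or <-] [s Os <-]; exists (r + s); first exact: intD.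
  by rewrite mulrDl.
- move=> r _ Or [s Os <-]; exists (r * s); first exact: intM.
  by rewrite mulrA.
Qed.

Section Coprime.

Variable n : integralIdeal.

Lemma coprime_idealP B :
  isIdeal B -> (exists2 x, B x & ideal_set n (1 - x)) -> coprime_ideal n B.
Proof.
have [[n0 nD nZ] nO] := ideal_proof n.
move=> [[B0 BD BZ] BO] [x Bx nx]; apply/seteqP; split.
  by move=> _ [y By [z nz <-]]; apply: intD; [exact: BO|exact: nO].
move=> y Oy; exists (y * x); first exact: BZ.
by exists (y * (1 - x)); [exact: nZ|rewrite -mulrDr subrKC mulr1].
Qed.

Lemma coprime_ideal1 B :
  coprime_ideal n B -> exists2 x, B x & ideal_set n (1 - x).
Proof.
move=> h; have : O 1 by exact: int1.
by rewrite -h => -[x Bx [y ny <-]]; exists x => //; rewrite addrC addKr.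
Qed.

Lemma coprime_ideal_mul B D : isIdeal B -> isIdeal D ->
  coprime_ideal n B -> coprime_ideal n D -> coprime_ideal n (idealMul B D).
Proof.
have [[n0 nD nZ] nO] := ideal_proof n.
move=> Bi Di /coprime_ideal1[x Bx nx] /coprime_ideal1[y Dy ny].
apply: coprime_idealP; first exact: ideal_mul.
exists (x * y); first exact: idealMul_mem.
have -> : 1 - x * y = (1 - x) + x * (1 - y) by rewrite mulrBr mulr1 addrA subrK.
by apply: nD => //; apply: nZ => //; exact: (proj2 Bi).
Qed.

Lemma coprime_ideal_O : coprime_ideal n O.
Proof.
have [[n0 _ _] _] := ideal_proof n.
by apply: (coprime_idealP ideal_O); exists 1; [exact: int1|rewrite subrr].
Qed.

Lemma rayIdeals_mul A B :
  rayIdeals n A -> rayIdeals n B -> rayIdeals n (idealMul A B).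
Proof.
move=> [Af [A1 [A2 [[? ?] [? ?] cA1 cA2 eA]]]].
move=> [Bf [B1 [B2 [[? ?] [? ?] cB1 cB2 eB]]]].
split; first exact: fracIdeal_mul.
exists (idealMul A1 B1), (idealMul A2 B2); split.
- by split; [exact: ideal_mul|exact: nonzero_mul].
- by split; [exact: ideal_mul|exact: nonzero_mul].
- exact: coprime_ideal_mul.
- exact: coprime_ideal_mul.
rewrite -eA -eB -idealMulA (idealMulA B) (idealMulC B) -(idealMulA _ B).
by rewrite idealMulA.
Qed.

Lemma rayIdeals_O : rayIdeals n O.
Proof.
split; first exact: fracIdeal_O.
exists O, O; split; try exact: coprime_ideal_O.
- by split; [exact: ideal_O|exact: nonzero_O].
- by split; [exact: ideal_O|exact: nonzero_O].
- exact: (idealMul1 submodule_O).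
Qed.

Lemma rayIdeals_inv A : idealMul (idealInv A) A = O ->
  rayIdeals n A -> rayIdeals n (idealInv A).
Proof.
move=> AV [Af [B [D [hB hD cB cD e]]]]; split; first exact: fracIdeal_inv.
exists D, B; split=> //.
by rewrite -e idealMulA AV idealMul1 //; have [[]] := hD.
Qed.

Lemma cong_star1_mul x y :
  cong_star1 n x -> cong_star1 n y -> cong_star1 n (x * y).
Proof.
have [[n0 nD nZ] nO] := ideal_proof n.
move=> [x0 [a [b [[Oa ca] [Ob cb] b0 nab ex]]]].
move=> [y0 [a' [b' [[Oa' ca'] [Ob' cb'] b0' nab' ey]]]].
split; first by rewrite mulf_neq0.
exists (a * a'), (b * b'); split.
- split; first exact: intM.
  by rewrite -principalM; apply: coprime_ideal_mul => //; exact: ideal_principal.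
- split; first exact: intM.
  by rewrite -principalM; apply: coprime_ideal_mul => //; exact: ideal_principal.
- by rewrite mulf_neq0.
- have -> : a * a' - b * b' = a' * (a - b) + b * (a' - b').
    by rewrite !mulrBr (mulrC a') (mulrC a') addrA subrK.
  by apply: nD; apply: nZ.
- by rewrite ex ey invfM mulrACA.
Qed.

Lemma cong_star1_1 : cong_star1 n 1.
Proof.
have [[n0 _ _] _] := ideal_proof n.
split; first exact: oner_neq0.
exists 1, 1; rewrite principal1 subrr divr1 oner_neq0.
by split=> //; split; try exact: int1; exact: coprime_ideal_O.
Qed.

Lemma cong_star1_inv x : cong_star1 n x -> cong_star1 n x^-1.
Proof.
move=> [x0 [a [b [ha hb b0 nab ex]]]]; split; first by rewrite invr_eq0.
exists b, a; split=> //.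
- by apply: contra_neq x0 => a0; rewrite ex a0 mul0r.
- by rewrite -opprB; apply: submoduleN => //; exact: (proj1 (ideal_proof n)).
- by rewrite ex invf_div.
Qed.

End Coprime.

End NumberField.

Arguments ringOfIntegers K _ : clear implicits.

(* The embedding [iqf_emb] realises the field as a subfield of the complex
   numbers C. *)
Record imagQuadField (C : numClosedFieldType) := ImagQuadField {
  iqf_sort :> fieldExtType rat;
  iqf_emb : {rmorphism iqf_sort -> C};
  iqf_dim : \dim {:iqf_sort} = 2;
  iqf_nonreal : exists x, iqf_emb x \isn't Num.real
}.

Lemma rat_integral (K : fieldExtType rat) (q : rat) :
  ringOfIntegers K q%:A -> exists m : int, q = m%:~R.
Proof.
move=> [p pm pq].
have pq' : root (map_poly intr p) q.
  have := pq; rewrite -(fmorph_root (in_alg K)) -map_poly_comp.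
  by rewrite (@eq_map_poly _ _ (_ \o _) intr) // => z; exact: rmorph_int.
have : (ratr q : algC) \in Aint.
  apply: (@root_monic_Aint (map_poly ratr (map_poly intr p))).
  - by rewrite fmorph_root.
  - by rewrite !monic_map.
  - apply/polyOverP => i; rewrite !coef_map /= ratr_int; exact: intr_int.
move=> /(Cint_rat_Aint (Crat_rat q))/intrP[m]; rewrite -(ratr_int _ m).
by move=> /(fmorph_inj (ratr : {rmorphism rat -> algC})) ->; exists m.
Qed.

Section ImagQuad.

Variables (C : numClosedFieldType) (K : imagQuadField C).
Local Notation emb := (@iqf_emb C K).
Local Notation O := (ringOfIntegers K).

Lemma emb_rat (k : rat) : emb (k%:A) = ratr k.
Proof. exact: (fmorph_eq_rat (emb \o in_alg K : {rmorphism rat -> C})). Qed.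

Lemma conj_ratr (k : rat) : (ratr k : C)^* = ratr k.
Proof. exact: (fmorph_eq_rat (Num.conj \o ratr : {rmorphism rat -> C})). Qed.

Lemma conj_exists (x : K) : exists y : K, emb y = (emb x)^* /\
  exists p q : rat, x + y = p%:A /\ x * y = q%:A.
Proof.
have [t tNreal] := iqf_nonreal K.
have fr : free [:: 1; t].
  rewrite free_cons seq1_free; apply/andP; split; last first.
    by apply: contraNneq tNreal => ->; rewrite rmorph0 real0.
  rewrite span_seq1; apply/vlineP => -[k e].
  have k0 : k != 0.
    by apply: contraTneq (oner_neq0 K) => k0; rewrite e k0 scale0r eqxx.
  have et : t = k^-1%:A by rewrite e scalerA mulVf // scale1r.
  by move/negP: tNreal; apply; apply/CrealP; rewrite et emb_rat conj_ratr.
have bas (z : K) : exists r s : rat, z = r%:A + s *: t.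
  have : z \in span [:: 1; t].
    suff -> : span [:: 1; t] = {:K}%VS by rewrite memvf.
    by apply/eqP; rewrite eqEdim subvf iqf_dim (eqP fr).
  rewrite span_cons span_seq1 => /memv_addP[_ /vlineP[r ->]].
  by move=> [_ /vlineP[s ->] ->]; exists r, s.
have scA (k : rat) (z : K) : k *: z = k%:A * z by rewrite mulr_algl.
have [p [q tt]] := bas (t * t).
have ctt : (emb t)^* * (emb t)^* = ratr p + ratr q * (emb t)^*.
  rewrite -!rmorphM tt rmorphD (scA q t) (rmorphM emb) !emb_rat.
  by rewrite rmorphD rmorphM /= !conj_ratr.
have ct : (emb t)^* = emb (q%:A - t).
  have nt : (emb t)^* - emb t != 0.
    by apply: contraNneq tNreal => /eqP; rewrite subr_eq0 => /eqP/CrealP.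
  apply: (mulfI nt); rewrite rmorphB /= emb_rat.
  have : emb t * emb t = ratr p + ratr q * emb t.
    by rewrite -rmorphM tt rmorphD (scA q t) rmorphM /= !emb_rat.
  set u := emb t; set v := u^* in ctt *; set P := ratr p; set Q := ratr q.
  rewrite -/P -/Q -/v in ctt; move=> utt.
  have : v * v - u * u = Q * (v - u).
    by rewrite ctt utt mulrBr opprD addrACA subrr add0r.
  have -> : (v - u) * (Q - u) = Q * (v - u) - (v * u - u * u).
    by rewrite mulrBr mulrC -mulrBl.
  move=> <-; rewrite mulrBl (mulrC u v) opprB addrA subrK.
  by rewrite addrC.
have [r [s ->]] := bas x.
exists (r%:A + s *: (q%:A - t)); split.
  by rewrite (scA s) (scA s) !rmorphD !rmorphM /= !emb_rat conj_ratr conj_ratr ct.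
have AD (a b : rat) : (a + b)%:A = a%:A + b%:A :> K by rewrite scalerDl.
have AM (a b : rat) : (a * b)%:A = a%:A * b%:A :> K.
  by rewrite -scA scalerA.
have AB (a b : rat) : (a - b)%:A = a%:A - b%:A :> K by rewrite scalerBl.
have pE : p%:A = t * t - q%:A * t by rewrite tt (scA q) addrK.
exists (r + r + s * q), (r * r + r * s * q - s * s * p); split.
  rewrite (scA s t) (scA s (_ - _)) !AD AM; ring.
rewrite (scA s t) (scA s (_ - _)) AB !AD !AM pE; ring.
Qed.

Definition conjK (x : K) : K := projT1 (cid (conj_exists x)).

Lemma emb_conjK x : emb (conjK x) = (emb x)^*.
Proof. exact: (proj1 (projT2 (cid (conj_exists x)))). Qed.

Lemma conjK_trace x : exists p : rat, x + conjK x = p%:A.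
Proof.
by have [_ [p [q [? ?]]]] := projT2 (cid (conj_exists x)); exists p.
Qed.

Lemma conjK_norm x : exists q : rat, x * conjK x = q%:A.
Proof.
by have [_ [p [q [? ?]]]] := projT2 (cid (conj_exists x)); exists q.
Qed.

Lemma conjKM x y : conjK (x * y) = conjK x * conjK y.
Proof. by apply: (fmorph_inj emb); rewrite !(emb_conjK, rmorphM). Qed.

Lemma conjKD x y : conjK (x + y) = conjK x + conjK y.
Proof. by apply: (fmorph_inj emb); rewrite !(emb_conjK, rmorphD). Qed.

Lemma conjKK : involutive conjK.
Proof. by move=> x; apply: (fmorph_inj emb); rewrite !emb_conjK conjCK. Qed.

Lemma conjK_eq0 x : (conjK x == 0) = (x == 0).
Proof. by rewrite -(fmorph_eq0 emb) emb_conjK conjC_eq0 fmorph_eq0. Qed.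

Lemma int_conjK x : O x -> O (conjK x).
Proof.
move=> [p pm px]; exists p => //.
rewrite -(fmorph_root emb) emb_conjK.
have e : map_poly emb (map_poly intr p) = map_poly Num.conj (map_poly intr p) :> {poly C}.
  by apply/polyP => i; rewrite !coef_map /= !rmorph_int.
rewrite e fmorph_root.
have -> : map_poly intr p = map_poly emb (map_poly intr p) :> {poly C}.
  by apply/polyP => i; rewrite !coef_map /= rmorph_int.
by rewrite fmorph_root.
Qed.

Lemma int_trace x : O x -> exists m : int, x + conjK x = m%:~R.
Proof.
move=> Ox; have [q e] := conjK_trace x.
have : O q%:A by rewrite -e; apply: intD => //; exact: int_conjK.
by move=> /rat_integral[m qm]; exists m; rewrite e qm scaler_int.
Qed.

Lemma int_norm x : O x -> exists m : int, x * conjK x = m%:~R.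
Proof.
move=> Ox; have [q e] := conjK_norm x.
have : O q%:A by rewrite -e; apply: intM => //; exact: int_conjK.
by move=> /rat_integral[m qm]; exists m; rewrite e qm scaler_int.
Qed.

Lemma int_quadratic (x : K) (a b : int) :
  x * x - a%:~R * x + b%:~R = 0 -> O x.
Proof.
move=> e; exists ('X^2 - a%:P * 'X + b%:P).
  rewrite monicE -addrA lead_coefDl ?lead_coefXn //.
  rewrite size_polyXn (leq_ltn_trans (size_polyD _ _)) // gtn_max.
  rewrite size_polyN (leq_ltn_trans (size_polyMleq _ _)) ?size_polyX //=;
    last by rewrite addn2 /= ltnS; exact: size_polyC_leq1.
  by rewrite (leq_ltn_trans (size_polyC_leq1 _)).
by rewrite /root !(rmorphD, rmorphN, rmorphM, rmorphXn) /= !map_polyC map_polyX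
  !(hornerE, hornerXn) /= expr2 e.
Qed.

Lemma quadratic_identity (F : fieldType) (x y x' y' g : F) :
  x * y' / g * (x * y' / g) - (x * y' + x' * y) / g * (x * y' / g)
  + x * x' / g * (y * y' / g) = 0.
Proof. by ring. Qed.

Lemma fracIdeal_mulV (A : set K) :
  isFracIdeal A -> idealMul (idealInv A) A = O.
Proof.
move=> Af; have [[iA0 iAD iAZ] _ _] := fracIdeal_inv Af.
have iAm : isSubmodule (idealInv A) by [].
have [[A0 AD AZ] [a0 Aa0 a0n0] [d [Od d0 Ad]]] := Af.
pose DA : set K := [set d * a | a in A].
pose P := idealMul DA (conjK @` DA).
have DAO x : DA x -> O x by move=> [a Aa <-]; exact: Ad.
have DAD x y : DA x -> DA y -> DA (x + y).
  by move=> [a Aa <-] [b Ab <-]; exists (a + b); [exact: AD|rewrite mulrDr].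
have Pmem x y : DA x -> DA y -> P (x * conjK y).
  by move=> hx hy; apply: idealMul_mem => //; exists y.
have PN x : P x -> P (- x).
  move: x; apply: (@idealMul_min _ _ _ [set x | P (- x)]).
  - by rewrite /= oppr0; exact: idealMul0.
  - by move=> x y /= hx hy; rewrite opprD; exact: idealMulD.
  - move=> _ y [a Aa <-] hy /=; rewrite -mulNr; apply: idealMul_mem => //.
    exists (- a); last by rewrite mulrN.
    by rewrite -mulN1r; apply: AZ => //; exact: (intZ _ (-1)).
have PM (m : int) x : P x -> P (m%:~R * x).
  move=> Px; have PMn (k : nat) : P (k%:R * x).
    elim: k => [|k IH]; first by rewrite mul0r; exact: idealMul0.
    by rewrite -natr1 mulrDl mul1r; exact: idealMulD.
  case: m => k; first exact: PMn.
  by rewrite NegzE rmorphN mulNr; apply: PN; exact: PMn.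
have norm_pos x : x != 0 -> O x ->
    exists k : nat, [/\ (0 < k)%N & x * conjK x = k%:R].
  move=> x0 Ox; have [m e] := int_norm Ox.
  have : (0 : C) < m%:~R.
    have -> : m%:~R = emb x * (emb x)^* :> C.
      by rewrite -emb_conjK -rmorphM e rmorph_int.
    by rewrite -normCK exprn_gt0 // normr_gt0 fmorph_eq0.
  by rewrite ltr0z; case: m e => // k e k0; exists k.
pose G := [pred k : nat | (0 < k)%N && `[< P k%:R >]].
have exG : exists k, G k.
  have [k [k0 ek]] := norm_pos (d * a0) (mulf_neq0 d0 a0n0) (Ad _ Aa0).
  exists k; rewrite /= k0; apply/asboolP; rewrite -ek.
  by apply: Pmem; exists a0.
have [g /andP[g0 /asboolP Pg] gmin] := ex_minnP exG.
have g0K : g%:R != 0 :> K.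
  by rewrite -(fmorph_eq0 emb) rmorph_nat pnatr_eq0 -lt0n.
have Gdvd (m : int) : P m%:~R -> exists q : int, m = q * g%:Z.
  move=> Pm; exists (m %/ g)%Z.
  have gz : g%:Z != 0 by rewrite -lt0n.
  have Pr : P (m %% g)%Z%:~R.
    have -> : (m %% g)%Z%:~R = m%:~R - (m %/ g)%Z%:~R * g%:R :> K.
      by rewrite /modz intrB intrM.
    by apply: idealMulD => //; apply: PN; exact: PM.
  have r0 : (0 <= (m %% g)%Z) by rewrite modz_ge0.
  have rg : ((m %% g)%Z < g%:Z) by rewrite ltz_pmod.
  rewrite {1}(divz_eq m g).
  move: Pr r0 rg; case: (m %% g)%Z => // k Pk _; rewrite ltz_nat => kg.
  case: k Pk kg => [|k] Pk kg; first by rewrite addr0.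
  have /gmin : G k.+1 by rewrite /=; apply/asboolP.
  by rewrite leqNgt kg.
have key x y : DA x -> DA y -> O (x * conjK y / g%:R).
  move=> hx hy; have [t et] := int_trace (intM (DAO _ hx) (int_conjK (DAO _ hy))).
  rewrite conjKM conjKK in et.
  have Pt : P t%:~R by rewrite -et mulrC (mulrC _ y); apply: idealMulD;
    [rewrite mulrC; exact: Pmem|exact: Pmem].
  have Nd z : DA z -> exists q : int, z * conjK z = (q * g%:Z)%:~R.
    move=> hz; have [m em] := int_norm (DAO _ hz).
    have [|q eq] := Gdvd m; first by rewrite -em; exact: Pmem.
    by exists q; rewrite em eq.
  have [q eq] := Gdvd _ Pt; rewrite eq rmorphM /= in et.
  have [u eu] := Nd _ hx; have [v ev] := Nd _ hy; rewrite !rmorphM /= in eu ev.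
  apply: (@int_quadratic _ q (u * v)); rewrite rmorphM /=.
  have -> : q%:~R = (x * conjK y + conjK x * y) / g%:R by rewrite et mulfK.
  have -> : u%:~R = x * conjK x / g%:R by rewrite eu mulfK.
  have -> : v%:~R = y * conjK y / g%:R by rewrite ev mulfK.
  exact: quadratic_identity.
apply/seteqP; split.
  apply: idealMul_min; [exact: int0|exact: intD|].
  by move=> x y; apply.
have main z : P z -> idealMul (idealInv A) A (z / g%:R).
  move: z; apply: (@idealMul_min _ _ _ [set z | idealMul _ _ (z / g%:R)]).
  - by rewrite /= mul0r; exact: idealMul0.
  - by move=> x y /= hx hy; rewrite mulrDl; exact: idealMulD.
  - move=> _ _ [a Aa <-] [y hy <-] /=.
    have -> : d * a * conjK y / g%:R = (d * conjK y / g%:R) * a by ring.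
    apply: idealMul_mem => // b Ab.
    have -> : d * conjK y / g%:R * b = d * b * conjK y / g%:R by ring.
    by apply: key => //; exists b.
have one : idealMul (idealInv A) A 1 by rewrite -(divff g0K); exact: main.
have [_ _ IZ] := idealMul_submodule A iAm.
by move=> z Oz; rewrite -[z]mulr1; exact: IZ.
Qed.

End ImagQuad.

Section RayClassGroup.

Variables (C : numClosedFieldType) (K : imagQuadField C) (n : integralIdeal K).

Definition rayIdealGroup : Type := rayIdeals n.
HB.instance Definition _ := Choice.on rayIdealGroup.
HB.instance Definition _ := SubType.on rayIdealGroup.

Implicit Types a b c : rayIdealGroup.

Lemma rayIdealP a : rayIdeals n (val a).
Proof. exact: set_mem (valP a). Qed.

Lemma rayIdeal_submodule a : isSubmodule (val a).
Proof. by have [[]] := rayIdealP a. Qed.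

Lemma rayIdeal_mulV a : idealMul (idealInv (val a)) (val a) = ringOfIntegers K.
Proof. by apply: fracIdeal_mulV; have [] := rayIdealP a. Qed.

Definition mk_rayIdeal A (h : rayIdeals n A) : rayIdealGroup :=
  exist (fun A => A \in rayIdeals n) A (mem_set h).

Definition rayIdeal_one : rayIdealGroup := mk_rayIdeal (rayIdeals_O n).
Definition rayIdeal_mul a b : rayIdealGroup :=
  mk_rayIdeal (rayIdeals_mul (rayIdealP a) (rayIdealP b)).
Definition rayIdeal_inv a : rayIdealGroup :=
  mk_rayIdeal (rayIdeals_inv (rayIdeal_mulV a) (rayIdealP a)).

Fact rayIdeal_mulgC : commutative rayIdeal_mul.
Proof. by move=> a b; apply: val_inj; exact: idealMulC. Qed.
Fact rayIdeal_mulgA : associative rayIdeal_mul.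
Proof. by move=> a b c; apply: val_inj; exact: idealMulA. Qed.
Fact rayIdeal_mul1g : left_id rayIdeal_one rayIdeal_mul.
Proof.
by move=> a; apply: val_inj; exact: idealMul1 (rayIdeal_submodule a).
Qed.
Fact rayIdeal_mulg1 : right_id rayIdeal_one rayIdeal_mul.
Proof. by move=> a; rewrite rayIdeal_mulgC rayIdeal_mul1g. Qed.
Fact rayIdeal_mulVg : left_inverse rayIdeal_one rayIdeal_inv rayIdeal_mul.
Proof. by move=> a; apply: val_inj; exact: rayIdeal_mulV. Qed.
Fact rayIdeal_mulgV : right_inverse rayIdeal_one rayIdeal_inv rayIdeal_mul.
Proof. by move=> a; rewrite rayIdeal_mulgC rayIdeal_mulVg. Qed.

HB.instance Definition _ := isGroup.Build rayIdealGroup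
  rayIdeal_mulgA rayIdeal_mul1g rayIdeal_mulg1 rayIdeal_mulVg rayIdeal_mulgV.

Definition ray_congr : rel rayIdealGroup :=
  fun a b => `[< rayPrincipal n (val (a^-1 * b)%g) >].

Lemma rayPrincipalM a b : rayPrincipal n (val a) -> rayPrincipal n (val b) ->
  rayPrincipal n (val (a * b)%g).
Proof.
move=> [x hx ex] [y hy ey]; exists (x * y); first exact: cong_star1_mul.
by rewrite -principalM ex ey.
Qed.

Lemma rayPrincipalV a : rayPrincipal n (val a) -> rayPrincipal n (val a^-1%g).
Proof.
move=> [x hx ex]; exists x^-1; first exact: cong_star1_inv.
have x0 : x != 0 by case: hx.
have e : idealMul (principal x^-1) (val a) = ringOfIntegers K.
  by rewrite -ex principalM mulVf // principal1.
have eV : idealMul (val a) (val a^-1%g) = ringOfIntegers K.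
  exact: (congr1 val (mulgV a)).
have pm : isSubmodule (principal x^-1).
  have [[n0 nD nZ] _] := ideal_principal (int1 K).
  split.
  - by exists 0; [exact: int0|rewrite mul0r].
  - move=> _ _ [r Or <-] [s Os <-]; exists (r + s); first exact: intD.
    by rewrite mulrDl.
  - move=> r _ Or [s Os <-]; exists (r * s); first exact: intM.
    by rewrite mulrA.
rewrite -(idealMul1 pm) -eV idealMulC idealMulA e.
exact: idealMul1 (rayIdeal_submodule _).
Qed.

Lemma ray_congr_equiv : equiv_class_of ray_congr.
Proof.
split.
- move=> a; apply/asboolP; rewrite mulVg.
  by exists 1; [exact: cong_star1_1|exact: principal1].
- have sym a b : ray_congr a b -> ray_congr b a.
    by move/asboolP/rayPrincipalV; rewrite invgM invgK => h; apply/asboolP.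
  by move=> a b; apply/idP/idP; exact: sym.
- move=> b a c /asboolP hab /asboolP hbc; apply/asboolP.
  by have := rayPrincipalM hab hbc; rewrite -mulgA (mulgA b) mulgV mul1g.
Qed.

Canonical ray_congr_equivRel := EquivRelPack ray_congr_equiv.
Canonical ray_congr_encModRel := defaultEncModRel ray_congr.

Local Open Scope quotient_scope.

Definition rayClassGroup : Type := {eq_quot ray_congr}.
HB.instance Definition _ := Choice.on rayClassGroup.
HB.instance Definition _ := EqQuotient.on rayClassGroup.

Local Notation pi := (\pi_rayClassGroup : rayIdealGroup -> rayClassGroup).

Definition rayClass_one : rayClassGroup := pi 1%g.
Definition rayClass_mul (x y : rayClassGroup) : rayClassGroup :=
  pi (repr x * repr y)%g.
Definition rayClass_inv (x : rayClassGroup) : rayClassGroup :=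
  pi (repr x)^-1%g.

Lemma rayClass_eqP a b : reflect (pi a = pi b) (ray_congr a b).
Proof. exact: eqmodP. Qed.

Lemma ray_congr_repr a : ray_congr a (repr (pi a)).
Proof. by apply/rayClass_eqP; rewrite reprK. Qed.

Lemma rayClass_mulE a b : rayClass_mul (pi a) (pi b) = pi (a * b)%g.
Proof.
rewrite /rayClass_mul /rayClass_inv; apply/esym/rayClass_eqP/asboolP.
move: (repr _) (repr _) (ray_congr_repr a) (ray_congr_repr b).
move=> b' a' /asboolP ha /asboolP hb.
have C' (x y : rayIdealGroup) : (x * y = y * x)%g := rayIdeal_mulgC x y.
suff -> : ((a * b)^-1 * (a' * b') = a^-1 * a' * (b^-1 * b'))%g.
  exact: rayPrincipalM.
by rewrite invgM (C' b^-1%g) -!mulgA; congr (_ * _)%g; rewrite !mulgA (C' a').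
Qed.

Lemma rayClass_invE a : rayClass_inv (pi a) = pi a^-1%g.
Proof.
rewrite /rayClass_mul /rayClass_inv; apply/esym/rayClass_eqP/asboolP.
move: (repr _) (ray_congr_repr a) => a' /asboolP ha.
suff -> : (a^-1^-1 * a'^-1 = (a^-1 * a')^-1)%g by exact: rayPrincipalV.
by rewrite invgM invgK; exact: rayIdeal_mulgC.
Qed.

Lemma rayClass_ind (P : rayClassGroup -> Prop) :
  (forall a, P (pi a)) -> forall x, P x.
Proof. by move=> h x; rewrite -[x]reprK; exact: h. Qed.

Fact rayClass_mulA : associative rayClass_mul.
Proof.
elim/rayClass_ind=> a; elim/rayClass_ind=> b; elim/rayClass_ind=> c.
by rewrite !rayClass_mulE mulgA.
Qed.
Fact rayClass_mul1 : left_id rayClass_one rayClass_mul.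
Proof. by elim/rayClass_ind=> a; rewrite rayClass_mulE mul1g. Qed.
Fact rayClass_mulr1 : right_id rayClass_one rayClass_mul.
Proof. by elim/rayClass_ind=> a; rewrite rayClass_mulE mulg1. Qed.
Fact rayClass_mulV : left_inverse rayClass_one rayClass_inv rayClass_mul.
Proof.
by elim/rayClass_ind=> a; rewrite rayClass_invE rayClass_mulE mulVg.
Qed.
Fact rayClass_mulrV : right_inverse rayClass_one rayClass_inv rayClass_mul.
Proof.
by elim/rayClass_ind=> a; rewrite rayClass_invE rayClass_mulE mulgV.
Qed.

HB.instance Definition _ := isGroup.Build rayClassGroup
  rayClass_mulA rayClass_mul1 rayClass_mulr1 rayClass_mulV rayClass_mulrV.

(* The class [A] of an ideal A; the default value is taken only when A is not
   in I_K(n). *)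
Definition rayClass (A : set K) : rayClassGroup :=
  pi (insubd (1%g : rayIdealGroup) A).

End RayClassGroup.

Record binQuadForm := BinQuadForm { qa : int; qb : int; qc : int }.

Definition prod_of_form Q := (qa Q, qb Q, qc Q).
Definition form_of_prod p := BinQuadForm p.1.1 p.1.2 p.2.
Lemma prod_of_formK : cancel prod_of_form form_of_prod. Proof. by case. Qed.
HB.instance Definition _ := Choice.copy binQuadForm (can_type prod_of_formK).

Definition form_eval (Q : binQuadForm) (x y : int) : int :=
  qa Q * x ^+ 2 + qb Q * x * y + qc Q * y ^+ 2.

Definition form_disc (Q : binQuadForm) : int := qb Q ^+ 2 - 4 * qa Q * qc Q.

Definition primitive_form (Q : binQuadForm) : Prop :=
  gcdz (gcdz (qa Q) (qb Q)) (qc Q) = 1.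

Definition positive_definite (Q : binQuadForm) : Prop :=
  forall x y : int, (x, y) != (0, 0) -> 0 < form_eval Q x y.

Definition forms (d : int) : set binQuadForm :=
  [set Q | [/\ primitive_form Q, positive_definite Q & form_disc Q = d]].

Definition formsN (d : int) (N : nat) : set binQuadForm :=
  [set Q | forms d Q /\ gcdz N (qa Q) = 1].

Section FormClasses.

Variables (C : numClosedFieldType) (K : imagQuadField C).

(* sqrtC is the square root with nonnegative imaginary part, so that this is
   the zero of Q(x, 1) in the upper half-plane. *)
Definition form_root (Q : binQuadForm) : C :=
  (- (qb Q)%:~R + sqrtC (form_disc Q)%:~R) / (2 * (qa Q)%:~R).

Definition lattice (alpha beta : C) : set C :=
  [set z | exists k m : int, z = k%:~R * alpha + m%:~R * beta].

(* [omega_Q, 1], which is contained in K when the discriminant of Q is that of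
   K, seen as a subset of K. *)
Definition form_lattice (Q : binQuadForm) : set K :=
  [set x | lattice (form_root Q) 1 (iqf_emb K x)].

Variables (n : integralIdeal K) (d : int) (N : nat).

Definition ray_equiv : rel (formsN d N) :=
  fun Q Q' => rayClass n (form_lattice (val Q))
              == rayClass n (form_lattice (val Q')).

Lemma ray_equiv_equiv : equiv_class_of ray_equiv.
Proof.
split=> [Q|Q Q'|Q' Q Q'']; rewrite /ray_equiv.
- exact: eqxx.
- exact: eq_sym.
- by move/eqP->.
Qed.

Canonical ray_equiv_equivRel := EquivRelPack ray_equiv_equiv.
Canonical ray_equiv_encModRel := defaultEncModRel ray_equiv.

Definition formClasses : Type := {eq_quot ray_equiv}%qT.
HB.instance Definition _ := Choice.on formClasses.
HB.instance Definition _ := EqQuotient.on formClasses.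

End FormClasses.

Arguments form_lattice {C} K Q _.

Definition formClass (C : numClosedFieldType) (K : imagQuadField C)
    (n : integralIdeal K) (d : int) (N : nat) (Q : formsN d N) :
  formClasses n d N := (\pi Q)%qT.

(* Main.v *)
Require Import Defs.
From mathcomp Require Import all_boot all_order all_algebra all_field.
From mathcomp Require Import boolp classical_sets ring zify.

Set Implicit Arguments.
Unset Strict Implicit.
Unset Printing Implicit Defensive.

Import Order.TTheory GRing.Theory Num.Theory.
Local Open Scope classical_set_scope.
Local Open Scope ring_scope.

(** Injectivity is the definition of the equivalence, so the content is that
    every ray class contains some [omega_Q, 1] with leading coefficient of Q
    prime to N. Scale an ideal of the class by an element congruent to 1 mod n
    so that it becomes an integral ideal A prime to n, pick b in A congruent to
    1 mod n, and write A = g[a, beta] with beta = (-b' + sqrt d)/2. On A the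
    normalized norm f(x) = N(x)/N(A), where N(A) = g^2 a, is the integral form
    (a, -b', c). As N(A) lies in A, every b + k(1 - b)N(A) lies in A and is
    congruent to 1 mod n, and since N divides N(1 - b),
      f(b + k(1 - b)N(A)) = f(b) + k(1 - N(A)f(b))  mod N,
    which is prime to N for a suitable k because f(b) and 1 - N(A)f(b) are
    coprime. Moving the coordinates by multiples of N makes them coprime as
    well. The resulting lam satisfies A/lam = [omega_Q, 1] with f(lam) a
    multiple of the leading coefficient of Q. *)

(** * Coprimality and subgroups of the integers *)

Lemma coprimez_primeP (u v : int) : v != 0 ->
  (forall p : nat, prime p -> (p %| u)%Z -> (p %| v)%Z -> False) ->
  coprimez u v.
Proof.
move=> v0 h; rewrite /coprimez /gcdz; apply/negP => /negP g1.
have g0 : (0 < gcdn `|u| `|v|)%N by rewrite gcdn_gt0 !absz_gt0 v0 orbT.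
have /pdivP[p pp] : (1 < gcdn `|u| `|v|)%N.
  by move: g0 g1; case: (gcdn _ _) => [|[]].
by rewrite dvdn_gcd => /andP[pu pv]; apply: (h p).
Qed.

(* The factor k is the part of M prime to u: a prime p of M divides exactly one
   of u and k * v. *)
Lemma coprimez_lift (u v M : int) : M != 0 -> gcdz (gcdz u v) M = 1 ->
  exists k : int, coprimez (u + k * v) M.
Proof.
move=> M0 g1; have M0' : (0 < `|M|)%N by rewrite absz_gt0.
pose pi := [pred p : nat | ~~ (p %| `|u|)%N].
exists ((`|M|%N)`_pi)%N%:Z; apply: coprimez_primeP => // p pp puv pM.
have pk : (p %| (`|M|%N)`_pi)%N = (p \in pi).
  have := pi_of_part pi M0' p; rewrite !inE /= !mem_primes pp M0' part_gt0 /=.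
  by have -> : (p %| `|M|)%N = true by exact: pM.
have [pu|pu] := boolP (p %| u)%Z.
  have pu0 : (p %| `|u|)%N by exact: pu.
  move: puv; rewrite rpredDl // dvdzE abszM Euclid_dvdM // pk inE /= pu0 /=.
  move=> pv; have : (p %| gcdz (gcdz u v) M)%Z by rewrite !dvdz_gcd pu dvdzE pv pM.
  by rewrite g1 dvdzE dvdn1 => /eqP p1; move: (prime_gt1 pp); rewrite (p1 : p = 1%N).
move: puv; rewrite rpredDr; first exact/negP.
by rewrite dvdzE abszM Euclid_dvdM // pk inE /=; apply/orP; left.
Qed.

(** The least positive member generates [S] by division with remainder. In [ideal_normal_form] this
    is applied to the integers in an ideal and to the coordinates of its elements along [tau]. *)
Lemma int_subgroup (S : set int) (s : int) :
  (forall x y, S x -> S y -> S (x - y)) -> S s -> s != 0 ->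
  exists2 g : int, 0 < g & forall m, S m <-> (g %| m)%Z.
Proof.
move=> SB Ss s0.
have S0 : S 0 by rewrite -(subrr s); exact: SB.
have SN x : S x -> S (- x) by rewrite -sub0r; exact: SB.
have SD x y : S x -> S y -> S (x + y) by move=> ? /SN; rewrite -{2}[y]opprK; exact: SB.
have SMn x k : S x -> S (k%:Z * x).
  move=> Sx; elim: k => [|k IH]; first by rewrite mul0r.
  by rewrite intS mulrDl mul1r; exact: SD.
have SM m x : S x -> S (m * x).
  by move=> Sx; case: (intP m) => [|k|k]; [rewrite mul0r|exact: SMn|
    rewrite mulNr; exact/SN/SMn].
have Sabs : exists k : nat, (0 < k)%N && `[< S k%:Z >].
  exists `|s|%N; rewrite absz_gt0 s0 /=; apply/asboolP.
  by rewrite abszE; case: (ger0P s) => _ //; exact: SN.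
have [g /andP[g0 /asboolP Sg] gmin] := ex_minnP Sabs.
exists g%:Z => // m; split; last by case/dvdzP => q ->; exact: SM.
move=> Sm; apply/dvdz_mod0P.
have Sr : S (m %% g)%Z by rewrite /modz; apply: SB => //; exact: SM.
have r0 : 0 <= (m %% g)%Z by rewrite modz_ge0 // -lt0n.
have rg : (m %% g)%Z < g%:Z by rewrite ltz_pmod.
move: Sr r0 rg; case: (m %% g)%Z => // k Sk _; rewrite ltz_nat => kg.
case: k Sk kg => // k Sk; rewrite ltnNge => /negP[]; apply: gmin.
by rewrite /=; exact/asboolP.
Qed.

(** By Cayley-Hamilton [M *m M] is also [\tr M *: M] minus a scalar matrix, so [(p - \tr M) *: M] is
    scalar; the proof compares entries. The size is a variable with an equation because [\dim {:K}]
    equals 2 only through a proof. *)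
Lemma quadratic_mx2_scalar (F : fieldType) (m : nat) (M : 'M[F]_m) (p q : F) :
  m = 2 -> M *m M = p *: M - q%:M -> p != \tr M -> exists c, M = c%:M.
Proof.
move=> em; subst m; set i0 : 'I_2 := ord0; set i1 : 'I_2 := lift ord0 ord0.
move=> e; have tr : \tr M = M i0 i0 + M i1 i1 by rewrite /mxtrace big_ord_recl big_ord1.
rewrite {}tr => tr.
have ee i j : M i i0 * M i0 j + M i i1 * M i1 j = p * M i j - q *+ (i == j).
  move/matrixP: e => /(_ i j); rewrite !mxE big_ord_recl big_ord1 => ->.
  by [].
have np : M i0 i0 + M i1 i1 - p != 0 by rewrite subr_eq0 eq_sym.
have z01 : M i0 i1 = 0.
  apply: (mulIf np); rewrite mul0r.
  by have /eqP := ee i0 i1; rewrite /= subr0 -subr_eq0 => /eqP <-; ring.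
have z10 : M i1 i0 = 0.
  apply: (mulIf np); rewrite mul0r.
  by have /eqP := ee i1 i0; rewrite /= subr0 -subr_eq0 => /eqP <-; ring.
have z : M i0 i0 = M i1 i1.
  apply/eqP; rewrite -subr_eq0; apply/eqP; apply: (mulIf np); rewrite mul0r.
  have /eqP := ee i0 i0; have := ee i1 i1; rewrite z01 z10 /= => h1.
  rewrite -(subr_eq0 (_ + _)) => /eqP <-.
  have -> : q *+ 1 = p * M i1 i1 - M i1 i1 * M i1 i1.
    rewrite -[X in _ - X](add0r) -{1}(mul0r 0) h1; ring.
  by ring.
exists (M i0 i0); apply/matrixP=> i j; rewrite mxE.
have two (k : 'I_2) : k = i0 \/ k = i1.
  by case: k => [[|[|//]] hk]; [left|right]; apply: val_inj.
by case: (two i) => ->; case: (two j) => ->; rewrite /= ?mulr1n ?mulr0n.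
Qed.

(** * Traces, and an integral basis containing 1 *)

Section ImagQuadBasics.

Variables (C : numClosedFieldType) (K : imagQuadField C).
Local Notation emb := (@iqf_emb C K).
Local Notation O := (ringOfIntegers K).

Lemma conjK_rat (q : rat) : conjK (q%:A : K) = q%:A.
Proof. by apply: (fmorph_inj emb); rewrite emb_conjK emb_rat conj_ratr. Qed.

Lemma conjK_int (m : int) : conjK (m%:~R : K) = m%:~R.
Proof. by rewrite -scaler_int conjK_rat. Qed.

(** The matrix of multiplication by x satisfies M^2 = pM - q with p = x + [conjK x] and q = x *
    [conjK x]. If p were not its trace, M would be scalar, so x would be rational and p = 2x would
    be the trace after all. *)
Lemma fieldTraceE (x : K) : (fieldTrace x)%:A = x + conjK x.
Proof.
have [p ep] := conjK_trace x; have [q eq] := conjK_norm x.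
rewrite ep; congr (_ *: _).
have ebas := vbasisP {:K}.
set M := passmx.mxof (vbasis {:K}) (vbasis {:K}) (amull x).
have rZ k u : passmx.rVof (vbasis {:K}) (k *: u) = k *: passmx.rVof (vbasis {:K}) u.
  by apply/rowP => i; rewrite !mxE linearZ.
have rB u v : passmx.rVof (vbasis {:K}) (u - v) =
    passmx.rVof (vbasis {:K}) u - passmx.rVof (vbasis {:K}) v.
  by apply/rowP => i; rewrite !mxE linearB.
have app u : passmx.rVof (vbasis {:K}) (x * u) = passmx.rVof (vbasis {:K}) u *m M.
  by rewrite -passmx.rVof_app // lfunE.
have inj (A B : 'M_(\dim {:K})) :
    (forall u, passmx.rVof (vbasis {:K}) u *m A = passmx.rVof (vbasis {:K}) u *m B) -> A = B.
  move=> h; apply/row_matrixP => i; rewrite !rowE.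
  by rewrite -(passmx.vecofK ebas (delta_mx _ _)) h.
have M2 : M *m M = p *: M - q%:M.
  apply: inj => u; rewrite mulmxA -!app mulmxBr -scalemxAr -app mul_mx_scalar.
  rewrite -!rZ -rB; congr (passmx.rVof _ _).
  rewrite -(mulr_algl p) -(mulr_algl q) -ep -eq; ring.
apply/esym/eqP; apply: contra_eqT isT => np.
have [c ec] := quadratic_mx2_scalar (iqf_dim K) M2 np.
have xc : x = c%:A.
  apply: (can_inj (passmx.rVofK ebas)).
  by rewrite -[x]mulr1 app ec mul_mx_scalar rZ.
have pc : p = c + c.
  by apply: (fmorph_inj (in_alg K)); rewrite /= -ep xc conjK_rat scalerDl.
by case/eqP: np; rewrite [RHS](congr1 mxtrace ec) mxtrace_scalar iqf_dim pc mulr2n.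
Qed.

Lemma conjKB (x y : K) : conjK (x - y) = conjK x - conjK y.
Proof. by apply: (fmorph_inj emb); rewrite !(emb_conjK, rmorphB). Qed.

Lemma intr_integral_inv (e : int) : e != 0 -> O (e%:~R^-1) -> (e %| 1)%Z.
Proof.
move=> e0; have eK : (e%:~R : K) != 0 by rewrite -(fmorph_eq0 emb) rmorph_int intr_eq0.
have -> : (e%:~R : K)^-1 = (e%:~R^-1 : rat)%:A.
  rewrite -[RHS]/(in_alg K _) fmorphV rmorph_int; done.
move=> /rat_integral[m em]; apply/dvdzP; exists m.
by apply/eqP; rewrite -(eqr_int rat) intrM -em mulVf // intr_eq0.
Qed.

(** The element 1 is primitive in O: if e is the gcd of its coordinates, then 1/e is integral, so e
    divides 1. Hence 1 extends to a basis 1, tau of O, and a unimodular change of basis preserves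
    the discriminant. *)
Lemma integral_basis1 (d : int) : isDiscriminant K d ->
  exists tau : K,
    [/\ forall x, O x <-> exists k m : int, x = k%:~R + m%:~R * tau,
        forall x, exists r s : rat, x = r%:A + s *: tau
      & (tau - conjK tau) ^+ 2 = d%:~R].
Proof.
case=> w [wbas eO ed].
have [w0 [w1 [{}eO wspan {}ed]]] : exists w0 w1 : K,
    [/\ O = [set x | exists k m : int, x = k%:~R * w0 + m%:~R * w1],
        forall x, exists r s : rat, x = r *: w0 + s *: w1
      & d%:~R = fieldTrace (w0 * w0) * fieldTrace (w1 * w1)
                - fieldTrace (w0 * w1) ^+ 2].
  have spanw x : exists c : 'I_(\dim {:K}) -> rat, x = \sum_i c i *: w`_i.
    by exists (fun i => coord w i x); rewrite -(coord_basis wbas) // memvf.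
  (* The dimension is generalized together with [w] so that it can be replaced by 2. *)
  move: (\dim {:K}) (iqf_dim K) w eO spanw ed {wbas} => m em; subst m.
  move=> w eO spanw ed; exists w`_0, w`_1; split.
  - rewrite eO; apply/seteqP; split=> x /=.
      by move=> [c ->]; exists (c ord0), (c (lift ord0 ord0)); rewrite big_ord_recl big_ord1.
    move=> [k [m ->]]; exists (fun i => if i == ord0 then k else m).
    by rewrite big_ord_recl big_ord1.
  - move=> x; have [c ->] := spanw x.
    by exists (c ord0), (c (lift ord0 ord0)); rewrite big_ord_recl big_ord1.
  rewrite ed (expand_det_row _ ord0) !big_ord_recl big_ord0 /cofactor /=.
  rewrite !(expand_det_row _ ord0) !big_ord_recl !big_ord0 /cofactor !det_mx00 !mxE /=.
  rewrite [w`_1 * w`_0]mulrC /bump /=; ring.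
have /= Omem k m : O (k%:~R * w0 + m%:~R * w1) by rewrite eO; exists k, m.
have [m0 [m1 e1]] : [set x | exists k m : int, x = k%:~R * w0 + m%:~R * w1] (1 : K).
  by rewrite -eO; exact: int1.
have mulE (x : K) : x = x * (m0%:~R * w0 + m1%:~R * w1) by rewrite -e1 mulr1.
have cop : coprimez m0 m1.
  set e := gcdz m0 m1.
  have e0 : e != 0.
    apply: contraTneq (oner_neq0 K) => /eqP; rewrite gcdz_eq0 => /andP[/eqP z0 /eqP z1].
    by rewrite e1 z0 z1 !mul0r addr0 eqxx.
  have eK : (e%:~R : K) != 0 by rewrite -(fmorph_eq0 emb) rmorph_int intr_eq0.
  have /dvdzP[q0] := dvdz_gcdl m0 m1; have /dvdzP[q1] := dvdz_gcdr m0 m1.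
  rewrite -/e => eq1 eq0.
  suff : (e %| 1)%Z by rewrite dvdz1.
  apply: intr_integral_inv => //.
  suff -> : (e%:~R^-1 : K) = q0%:~R * w0 + q1%:~R * w1 by [].
  apply: (mulfI eK); rewrite mulfV // [LHS]e1 [in LHS]eq0 [in LHS]eq1 !intrM; ring.
have [[u v] /= euv] := coprimezP _ _ cop.
have euvK : u%:~R * m0%:~R + v%:~R * m1%:~R = 1 :> K by rewrite -!intrM -intrD euv.
(* The Bezout coefficients complete the coordinates (m0, m1) of 1 by a second row (-v, u), with
   determinant 1. *)
pose tau := u%:~R * w1 - v%:~R * w0.
have ew0 : w0 = u%:~R - m1%:~R * tau.
  by rewrite -[LHS]mul1r -[X in X * _ = _]euvK [u%:~R in RHS]mulE /tau; ring.
have ew1 : w1 = v%:~R + m0%:~R * tau.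
  by rewrite -[LHS]mul1r -[X in X * _ = _]euvK [v%:~R in RHS]mulE /tau; ring.
exists tau; split.
- move=> x; rewrite eO; split=> -[k [m ->]].
    exists (k * u + m * v), (m * m0 - k * m1).
    by rewrite !(intrD, rmorphN, intrM) /= {1}ew0 {1}ew1; ring.
  exists (k * m0 - m * v), (k * m1 + m * u).
  by rewrite !(intrD, rmorphN, intrM) /= [k%:~R in LHS]mulE /tau; ring.
- move=> x; have [r [s ->]] := wspan x.
  exists (r * u%:~R + s * v%:~R), (s * m0%:~R - r * m1%:~R).
  rewrite -(mulr_algl r) -(mulr_algl s) -(mulr_algl (s * _ - _)).
  have AM (a b : rat) : (a * b)%:A = a%:A * b%:A :> K by exact: (rmorphM (in_alg K)).
  rewrite scalerBl scalerDl !AM !scaler_int {1}ew0 {1}ew1; ring.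
have -> : (d%:~R : K) = in_alg K d%:~R by rewrite rmorph_int.
rewrite ed rmorphB rmorphM rmorphXn /= !fieldTraceE !conjKM.
have -> : conjK w0 = u%:~R - m1%:~R * conjK tau.
  by rewrite {1}ew0 conjKB conjKM !conjK_int.
have -> : conjK w1 = v%:~R + m0%:~R * conjK tau.
  by rewrite {1}ew1 conjKD conjKM !conjK_int.
rewrite {1 2 3}ew0 {1 2 3}ew1.
(* The discriminant is the square of [w0 * conjK w1 - w1 * conjK w0]; inserting the determinant 1 as
   a factor turns the goal into a polynomial identity. *)
have -> : tau - conjK tau = (u%:~R * m0%:~R + v%:~R * m1%:~R) * (tau - conjK tau).
  by rewrite euvK mul1r.
ring.
Qed.

Lemma intrK_eq0 (m : int) : (m%:~R == 0 :> K) = (m == 0).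
Proof. by rewrite -(fmorph_eq0 emb) rmorph_int intr_eq0. Qed.

Lemma intrK_inj : injective (fun m : int => m%:~R : K).
Proof. by move=> x y /eqP; rewrite -subr_eq0 -intrB intrK_eq0 subr_eq0 => /eqP. Qed.

(** The difference tau - [conjK tau] is a nonzero square root of d that conjugation negates, whence
    d < 0. It is [sqrtC d%:~R] up to sign, and exchanging tau with its conjugate corrects the
    sign. *)
Lemma integral_basis_sqrt (d : int) : isDiscriminant K d ->
  d < 0 /\ exists theta : K, exists t n : int,
    [/\ emb theta = sqrtC d%:~R, t ^+ 2 - 4 * n = d
      & forall x, O x <->
          exists k m : int, x = k%:~R + m%:~R * ((t%:~R + theta) / 2)].
Proof.
move=> /integral_basis1[tau [eO spn ed]].
have Otau : O tau by apply/eO; exists 0, 1; rewrite add0r mul1r.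
have [t et] := int_trace Otau; have [n en] := int_norm Otau.
pose dl := tau - conjK tau.
have dl0 : dl != 0.
  have [z zNreal] := iqf_nonreal K; apply: contraNneq zNreal => /eqP.
  rewrite subr_eq0 => /eqP etau; have [r [s ->]] := spn z.
  apply/CrealP; rewrite -(mulr_algl s) rmorphD rmorphM /= !emb_rat.
  by rewrite rmorphD rmorphM /= !conj_ratr -emb_conjK -etau.
have dlC : (emb dl)^* = - emb dl.
  by rewrite -emb_conjK conjKB conjKK -rmorphN opprB.
have embd : emb dl ^+ 2 = d%:~R by rewrite -rmorphXn ed rmorph_int.
split.
  rewrite -(ltrz0 C) -embd -[X in X < 0]opprK oppr_lt0.
  have -> : - emb dl ^+ 2 = `|emb dl| ^+ 2 by rewrite normCK dlC expr2 mulrN.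
  by rewrite exprn_gt0 // normr_gt0 fmorph_eq0.
have two : (2 : K) != 0 by rewrite (intrK_eq0 2).
have etd : t ^+ 2 - 4 * n = d.
  apply: intrK_inj; rewrite /= -ed intrB intrM rmorphXn /= -et -en; ring.
have /orP[/eqP s|/eqP s] : (emb dl == sqrtC d%:~R) || (emb dl == - sqrtC d%:~R).
  by rewrite -eqf_sqr sqrtCK embd.
  exists dl, t, n; split=> // x.
  suff -> : (t%:~R + dl) / 2 = tau by exact: eO.
  by apply: (mulIf two); rewrite mulfVK // -et /dl; ring.
exists (- dl), t, n; split=> //; first by rewrite rmorphN s opprK.
have -> : (t%:~R - dl) / 2 = conjK tau.
  by apply: (mulIf two); rewrite mulfVK // -et /dl; ring.
have ec : conjK tau = t%:~R - tau by rewrite -et addrC addKr.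
move=> x; rewrite eO; split=> -[k [m ->]]; exists (k + m * t), (- m);
  by rewrite !(intrD, intrM, rmorphN) /= ec; ring.
Qed.

End ImagQuadBasics.

(** * Scaling of ideals, and coprimality to n *)

Section Scale.

Variables (K : fieldExtType rat) (n : integralIdeal K).
Local Notation O := (ringOfIntegers K).

Lemma submodule_scale (A : set K) (x : K) :
  isSubmodule A -> isSubmodule [set x * y | y in A].
Proof.
move=> [A0 AD AZ]; split.
- by exists 0; rewrite ?mulr0.
- by move=> _ _ [y Ay <-] [z Az <-]; exists (y + z); [exact: AD|rewrite mulrDr].
- by move=> r _ Or [y Ay <-]; exists (r * y); [exact: AZ|rewrite mulrCA].
Qed.

Lemma idealMul_principal (A : set K) (x : K) :
  isSubmodule A -> idealMul A (principal x) = [set x * y | y in A].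
Proof.
move=> Am; have [B0 BD BZ] := submodule_scale x Am; apply/seteqP; split.
  apply: idealMul_min => // y _ Ay [r Or <-]; rewrite mulrA mulrC.
  by exists (y * r) => //; rewrite mulrC; case: Am => _ _; apply.
move=> _ [y Ay <-]; rewrite mulrC; apply: idealMul_mem => //.
by exists 1; [exact: int1|rewrite mul1r].
Qed.

(** If uN + va = 1, then va is an element of B congruent to 1 mod n. *)
Lemma coprime_int_ideal (B : set K) (a N : int) :
  isIdeal B -> B a%:~R -> ideal_set n N%:~R ->
  coprimez N a -> coprime_ideal n B.
Proof.
have [[n0 nD nZ] nO] := ideal_proof n.
move=> Bi Ba nN /coprimezP[[u v] /= uv]; apply: coprime_idealP => //.
have [[_ _ BZ] _] := Bi.
exists (v%:~R * a%:~R); first by apply: BZ => //; exact: intZ.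
have -> : 1 - v%:~R * a%:~R = u%:~R * N%:~R :> K.
  have uvK : u%:~R * N%:~R + v%:~R * a%:~R = 1 :> K by rewrite -!intrM -intrD uv.
  by rewrite -[X in X - _]uvK addrK.
by apply: nZ => //; exact: intZ.
Qed.

Lemma principal_submodule (x : K) : isSubmodule (principal x).
Proof.
have -> : principal x = [set x * r | r in O].
  by apply/seteqP; split=> _ [r Or <-]; exists r; rewrite // mulrC.
exact/submodule_scale/submodule_O.
Qed.

Lemma coprime_principal (x : K) : O x -> ideal_set n (1 - x) ->
  coprime_ideal n (principal x).
Proof.
move=> Ox nx; apply: coprime_idealP; first exact: ideal_principal.
by exists x => //; exists 1; [exact: int1|rewrite mul1r].
Qed.

Lemma cong_star1_integral (x : K) : x != 0 -> O x -> ideal_set n (1 - x) ->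
  cong_star1 n x.
Proof.
have [[n0 nD nZ] nO] := ideal_proof n.
move=> x0 Ox nx; split=> //; exists x, 1; split.
- by split=> //; exact: coprime_principal.
- by split; [exact: int1|apply: coprime_principal; rewrite ?subrr //; exact: int1].
- exact: oner_neq0.
- by rewrite -opprB; exact: submoduleN (proj1 (ideal_proof n)) nx.
- by rewrite divr1.
Qed.

(** Let AD = B with B and D integral and prime to n. For x in D congruent to 1 mod n, the ideal xA
    lies in B, hence is integral. If y in B is congruent to 1, then so is xy, an element of xA. *)
Lemma rayIdeal_integral_scale (A : set K) : rayIdeals n A ->
  exists x : K, [/\ cong_star1 n x, isIdeal [set x * y | y in A],
    nonzero [set x * y | y in A] & coprime_ideal n [set x * y | y in A]].
Proof.
have [[n0 nD nZ] nO] := ideal_proof n.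
move=> [[[A0 AD AZ] Anz _] [B [D [[Bi _] [Di Dnz] cB cD eB]]]].
have [x [Dx x0 nx]] : exists x, [/\ D x, x != 0 & ideal_set n (1 - x)].
  have [x Dx nx] := coprime_ideal1 cD.
  (* If x = 0 then 1 lies in n, so any nonzero element of D serves. *)
  have [x0|x0] := eqVneq x 0; last by exists x.
  have [z Dz z0] := Dnz; exists z; split=> //.
  rewrite -[_ - z]mulr1; apply: nZ; last by rewrite x0 subr0 in nx.
  by apply: intD; [exact: int1|exact/intN/(proj2 Di)].
have Ox : O x by exact: (proj2 Di).
have xAi : isIdeal [set x * y | y in A].
  split; first exact: submodule_scale.
  move=> _ [y Ay <-]; apply: (proj2 Bi).
  by rewrite -eB mulrC; exact: idealMul_mem.
exists x; split=> //; first exact: cong_star1_integral.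
  by have [y Ay y0] := Anz; exists (x * y); rewrite ?mulf_neq0 //; exists y.
have [y By ny] := coprime_ideal1 cB.
apply: coprime_idealP => //; exists (x * y).
  (* B = AD is contained in A because D is integral. *)
  exists y => //; move: By; rewrite -eB; apply: idealMul_min => // z w Az Dw.
  by rewrite mulrC; apply: AZ => //; exact: (proj2 Di).
have -> : 1 - x * y = (1 - x) + x * (1 - y) by ring.
by apply: nD => //; exact: nZ.
Qed.

Lemma leastPosInt_dvd (N : nat) (D : int) : isLeastPosInt n N ->
  ideal_set n D%:~R -> (N %| D)%Z.
Proof.
have [nm nO] := ideal_proof n; have [n0 nD nZ] := nm.
move=> [N0 nN Nmin] hD; apply/dvdz_mod0P.
have r0 : 0 <= (D %% N)%Z by rewrite modz_ge0 // -lt0n.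
have rN : (D %% N)%Z < N%:Z by rewrite ltz_pmod.
have : ideal_set n (D %% N)%Z%:~R.
  rewrite /modz intrB intrM; apply: nD => //; apply: submoduleN => //.
  by apply: nZ => //; exact: intZ.
case: (D %% N)%Z r0 rN => // -[|k] // _ kN nk.
by move: kN; rewrite ltz_nat ltnNge => /negP[]; exact: Nmin.
Qed.

End Scale.

(** Clears the denominators in the equation that makes [beta b / g] integral in [disc_primitive]. *)
Lemma monic_quadratic_scale (F : fieldType) (x g a b c : F) : g != 0 ->
  (x / g * (x / g) - - b * (x / g) + a * c) * g ^+ 2 =
  x ^+ 2 - (- (b * g * x) - a * g * (c * g)).
Proof. by move=> g0; field. Qed.

(** Complete the square: 4a times the form is (2ax + by)^2 - dy^2. *)
Lemma disc_form_gt0 (d a b c : int) : d < 0 -> 0 < a -> b ^+ 2 - 4 * a * c = d ->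
  forall x y : int, (x, y) != (0, 0) -> 0 < a * x ^+ 2 + b * x * y + c * y ^+ 2.
Proof.
move=> d0 a0 e x y xy0; have a4 : 0 < 4 * a by lia.
rewrite -(pmulr_rgt0 _ a4).
have -> : 4 * a * (a * x ^+ 2 + b * x * y + c * y ^+ 2) =
    (2 * a * x + b * y) ^+ 2 + - d * y ^+ 2 by rewrite -e; ring.
have [y0|y0] := eqVneq y 0.
  have x0 : x != 0 by apply: contra_neq xy0 => ->; rewrite y0.
  rewrite y0 mulr0 addr0 expr0n mulr0 addr0 exprn_even_gt0 //=.
  by rewrite !mulf_neq0 // lt0r_neq0.
by rewrite ltr_wpDl ?sqr_ge0 // mulr_gt0 ?oppr_gt0 // exprn_even_gt0.
Qed.

(** * Ideals and lattices attached to forms of discriminant d *)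

Section FormIdeals.

Variables (C : numClosedFieldType) (K : imagQuadField C).
Local Notation emb := (@iqf_emb C K).
Local Notation O := (ringOfIntegers K).

Variables (d : int) (theta : K) (t n0 : int).
Hypothesis d_lt0 : d < 0.
Hypothesis emb_theta : emb theta = sqrtC d%:~R.
Hypothesis disc_t : t ^+ 2 - 4 * n0 = d.
Hypothesis integralE : forall x, O x <->
  exists k m : int, x = k%:~R + m%:~R * ((t%:~R + theta) / 2).

(* a * omega_Q for Q = a x^2 + b x y + c y^2. *)
Definition beta (b : int) : K := (- b%:~R + theta) / 2.

Lemma two_neq0 : (2 : K) != 0. Proof. by rewrite (intrK_eq0 K 2). Qed.

Lemma theta_sq : theta ^+ 2 = d%:~R.
Proof. by apply: (fmorph_inj emb); rewrite rmorphXn /= emb_theta sqrtCK rmorph_int. Qed.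

(** With z = 2x - by the relation reads z = -y * theta, so z^2 = dy^2 with d < 0. *)
Lemma int_lincomb_beta_eq0 (b x y : int) :
  x%:~R + y%:~R * beta b = 0 -> x = 0 /\ y = 0.
Proof.
move=> e; have e2 : (2 * x - b * y)%:~R + y%:~R * theta = 0.
  by rewrite -(mulr0 2) -e /beta intrB !intrM; field; exact: two_neq0.
set z := 2 * x - b * y in e2.
have /intrK_inj h : (z ^+ 2)%:~R = (d * y ^+ 2)%:~R :> K.
  rewrite [RHS]intrM !rmorphXn /= -theta_sq -exprMn mulrC.
  by move/eqP: e2; rewrite addr_eq0 => /eqP ->; rewrite sqrrN.
have y0 : y = 0 by nia.
rewrite /z in h.
by split=> //; move: h; rewrite y0; nia.
Qed.

Lemma beta_sq (a b c : int) : b ^+ 2 - 4 * a * c = d ->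
  beta b ^+ 2 = - (b%:~R * beta b) - a%:~R * c%:~R.
Proof.
move=> e; have -> : a%:~R * c%:~R = (b%:~R ^+ 2 - theta ^+ 2) / 4 :> K.
  have four : (4 : K) != 0 by rewrite (intrK_eq0 K 4).
  apply: (mulIf four); rewrite mulfVK // theta_sq -e intrB rmorphXn /= !intrM; ring.
by rewrite /beta; field; rewrite two_neq0 (intrK_eq0 K 4).
Qed.

(** Since b^2 and t^2 are congruent mod 4, b and t have the same parity, so [beta b] differs from (t
    + theta)/2 by an integer. *)
Lemma integral_beta (a b c : int) : b ^+ 2 - 4 * a * c = d ->
  forall x, O x <-> exists k m : int, x = k%:~R + m%:~R * beta b.
Proof.
move=> e; have [f ef] : exists f : int, - b = t + 2 * f.
  have : (2 %| (t - b) * (t + b))%Z.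
    apply/dvdzP; exists (2 * (n0 - a * c)); move: disc_t e; lia.
  rewrite dvdzE abszM Euclid_dvdM // => /orP[] /dvdzP[q eq].
    by exists (q - t); lia.
  by exists (- q); lia.
have tf : (- b)%:~R = t%:~R + 2 * f%:~R :> K by rewrite ef intrD intrM.
have eb : beta b = (t%:~R + theta) / 2 + f%:~R.
  by rewrite /beta -rmorphN /= tf; field; exact: two_neq0.
move=> x; rewrite integralE; split=> -[k [m ->]].
  by exists (k - m * f), m; rewrite eb intrB intrM; ring.
by exists (k + m * f), m; rewrite eb intrD intrM; ring.
Qed.

(* For a common divisor g of a, b, c the element beta b / g is integral, which
   O = Z + Z (beta b) only allows for g = 1. *)
Lemma disc_primitive (a b c : int) : b ^+ 2 - 4 * a * c = d ->
  gcdz (gcdz a b) c = 1.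
Proof.
move=> e; suff : (gcdz (gcdz a b) c %| 1)%Z.
  by rewrite dvdz1 /gcdz /= => /eqP ->.
have : [/\ gcdz (gcdz a b) c %| a, gcdz (gcdz a b) c %| b & gcdz (gcdz a b) c %| c]%Z.
  by split; rewrite ?dvdz_gcdr // (dvdz_trans (dvdz_gcdl _ _)) ?dvdz_gcdl ?dvdz_gcdr.
move: (gcdz _ c) => g [/dvdzP[a' ea] /dvdzP[b' eb] /dvdzP[c' ec]].
have g0 : g != 0.
  apply/eqP => g0; move: e d_lt0; rewrite ea eb ec g0 !mulr0; lia.
have gK : (g%:~R : K) != 0 by rewrite intrK_eq0.
have : O (beta b / g%:~R).
  apply: (@int_quadratic _ _ _ (- b') (a' * c')).
  apply: (mulIf (expf_neq0 2 gK)); rewrite mul0r.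
  have /eqP := beta_sq e; rewrite -subr_eq0 => /eqP <-.
  have -> : a%:~R = a'%:~R * g%:~R :> K by rewrite -intrM -ea.
  have -> : b%:~R = b'%:~R * g%:~R :> K by rewrite -intrM -eb.
  have -> : c%:~R = c'%:~R * g%:~R :> K by rewrite -intrM -ec.
  rewrite rmorphN intrM /=.
  exact: monic_quadratic_scale.
move/(integral_beta e) => [k [m ekm]].
have [_ /eqP] : k * g = 0 /\ m * g - 1 = 0.
  apply: (@int_lincomb_beta_eq0 b).
  by rewrite intrB !intrM mulrBl mul1r addrA mulrAC -mulrDl -ekm mulfVK // subrr.
by rewrite subr_eq0 => /eqP mg; apply/dvdzP; exists m.
Qed.

(** As a lattice I is [al, y0 + g tau], where al generates the integers in I and g the
    tau-coordinates of I. Closure under O makes g divide al and y0, so I = g[a, e + tau], and makes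
    a divide the norm of e + tau; this quotient is c. *)
Lemma ideal_normal_form (I : set K) : isIdeal I -> nonzero I ->
  exists g a b c : int, [/\ 0 < g, 0 < a, b ^+ 2 - 4 * a * c = d
    & forall x, I x <-> exists k m : int,
        x = g%:~R * (k%:~R * a%:~R + m%:~R * beta b)].
Proof.
move=> [[I0 ID IZ] IO] [x0 Ix0 x0n0].
have IN x : I x -> I (- x) by exact: submoduleN.
have IB x y : I x -> I y -> I (x - y) by move=> ? /IN; exact: ID.
pose tau := (t%:~R + theta) / 2.
have tau2 : tau ^+ 2 = t%:~R * tau - n0%:~R.
  have -> : n0%:~R = (t%:~R ^+ 2 - theta ^+ 2) / 4 :> K.
    have four : (4 : K) != 0 by rewrite (intrK_eq0 K 4).
    apply: (mulIf four); rewrite mulfVK // theta_sq -disc_t intrB rmorphXn /= !intrM; ring.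
  by rewrite /tau; field; rewrite two_neq0 (intrK_eq0 K 4).
have Otau : O tau by apply/integralE; exists 0, 1; rewrite add0r mul1r.
have [s es] := int_norm (IO _ Ix0).
have Is : I s%:~R by rewrite -es mulrC; apply: IZ => //; exact/int_conjK/IO.
have s0 : s != 0 by rewrite -(intrK_eq0 K) -es mulf_neq0 ?conjK_eq0.
have [al al0 alP] : exists2 al : int, 0 < al & forall m : int, I m%:~R <-> (al %| m)%Z.
  by apply: (@int_subgroup [set m | I m%:~R] s) => //= x y; rewrite intrB; exact: IB.
have Ial : I al%:~R by apply/alP.
have [g g0 gP] : exists2 g : int, 0 < g &
    forall m : int, (exists x : int, I (x%:~R + m%:~R * tau)) <-> (g %| m)%Z.
  apply: (@int_subgroup [set m | exists x : int, I (x%:~R + m%:~R * tau)] al).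
  - move=> x y [x1 h1] [y1 h2]; exists (x1 - y1); have := IB _ _ h1 h2.
    by rewrite !intrB mulrBl opprD addrACA.
  - by exists 0; rewrite add0r mulrC; exact: IZ.
  - exact: lt0r_neq0.
have [y0 Iy0] : exists y : int, I (y%:~R + g%:~R * tau) by apply/gP.
have /dvdzP[a ea] : (g %| al)%Z by apply/gP; exists 0; rewrite add0r mulrC; exact: IZ.
(* The product of tau with y0 + g tau has tau-coordinate y0 + gt, a multiple of g. *)
have /dvdzP[e ee] : (g %| y0)%Z.
  rewrite -(rpredDr _ (dvdz_mulr t (dvdzz g))); apply/gP.
  exists (- (g * n0)).
  suff -> : (- (g * n0))%:~R + (y0 + g * t)%:~R * tau =
            tau * (y0%:~R + g%:~R * tau) by exact: IZ.
  transitivity (y0%:~R * tau + g%:~R * tau ^+ 2); last by ring.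
  by rewrite tau2 rmorphN intrD !intrM /=; ring.
have gn0 : g != 0 by exact: lt0r_neq0.
have a0 : 0 < a by rewrite -(pmulr_lgt0 _ g0) -ea.
have /dvdzP[c ec] : (a %| e ^+ 2 + e * t + n0)%Z.
  rewrite -(dvdz_mul2r gn0) -ea; apply/alP.
  (* This is the conjugate of e + tau; its product with g(e + tau) is g times the norm of e + tau,
     an integer in I and hence a multiple of al = ag. *)
  have Oe : O (e%:~R + t%:~R - tau).
    by apply/integralE; exists (e + t), (-1); rewrite intrD rmorphN mulN1r.
  have := IZ _ _ Oe Iy0; rewrite ee !(intrD, intrM).
  have -> : n0%:~R = t%:~R * tau - tau ^+ 2 by rewrite tau2 subKr.
  by congr I; ring.
(* The value of b is minus the trace of e + tau, so that [beta b] is e + tau. *)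
exists g, a, (- (2 * e + t)), c; split=> //.
  rewrite -disc_t; have -> : 4 * a * c = 4 * (c * a) by ring.
  by rewrite -ec; ring.
have eb : beta (- (2 * e + t)) = e%:~R + tau.
  have -> : beta (- (2 * e + t)) = (- - (2 * e + t)%:~R + theta) / 2.
    by rewrite /beta rmorphN.
  by rewrite opprK intrD intrM /tau; field; exact: two_neq0.
move=> x; rewrite eb; split; last first.
  move=> [k [m ->]].
  have -> : g%:~R * (k%:~R * a%:~R + m%:~R * (e%:~R + tau)) =
      k%:~R * al%:~R + m%:~R * (y0%:~R + g%:~R * tau).
    by rewrite ea ee !intrM; ring.
  by apply: ID; apply: IZ => //; exact: intZ.
move=> Ix; have /integralE[k [m exm]] := IO _ Ix.
have /gP/dvdzP[q eq] : exists x : int, I (x%:~R + m%:~R * tau) by exists k; rewrite -exm.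
have /alP/dvdzP[r er] : I (k - q * y0)%:~R.
  have := IB _ _ Ix (IZ _ _ (intZ K q) Iy0); congr I.
  by rewrite exm eq intrB !intrM -/tau; ring.
exists r, q; rewrite exm -/tau.
have -> : k = r * (a * g) + q * (e * g) by rewrite -ea -ee -er subrK.
by rewrite eq !(intrD, intrM); ring.
Qed.

(** Because theta maps to [sqrtC d%:~R], the root of Q is the image of [beta (qb Q) / (qa Q)%:~R],
    so the lattice can be described inside K. *)
Lemma form_latticeE (Q : binQuadForm) : 0 < qa Q -> form_disc Q = d ->
  forall x, form_lattice K Q x <->
    exists k m : int, x = k%:~R * (beta (qb Q) / (qa Q)%:~R) + m%:~R.
Proof.
move=> a0 dQ x.
have er : form_root C Q = emb (beta (qb Q) / (qa Q)%:~R).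
  rewrite /form_root dQ !(fmorph_div, rmorphD, rmorphN) /= !rmorph_int emb_theta.
  by rewrite invfM mulrA rmorph1.
rewrite /form_lattice /lattice /= er; split=> -[k [m e]]; exists k, m.
  by apply: (fmorph_inj emb); rewrite e rmorphD (rmorphM emb k%:~R) !rmorph_int mulr1.
by rewrite e rmorphD (rmorphM emb k%:~R) !rmorph_int mulr1.
Qed.

(** * Forms prime to N and ideals prime to n *)

Variables (n : integralIdeal K) (N : nat).
Hypothesis least_N : isLeastPosInt n N.

(** With w the root of Q, O = Z + Z aw, and aw maps 1 to aw and w to aw^2 = -bw - c. *)
Lemma form_lattice_submodule (Q : binQuadForm) : 0 < qa Q -> form_disc Q = d ->
  isSubmodule (form_lattice K Q).
Proof.
move=> a0 dQ; have LE := form_latticeE a0 dQ.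
have aK : ((qa Q)%:~R : K) != 0 by rewrite intrK_eq0; exact: lt0r_neq0.
split.
- by apply/LE; exists 0, 0; rewrite mul0r addr0.
- move=> _ _ /LE[k [m ->]] /LE[k' [m' ->]]; apply/LE; exists (k + k'), (m + m').
  by rewrite !intrD; ring.
- move=> r _ /(integral_beta dQ)[u [v ->]] /LE[k [m ->]].
  apply/LE; exists (u * k - v * k * qb Q + v * m * qa Q), (u * m - v * k * qc Q).
  set w := beta (qb Q) / (qa Q)%:~R.
  have ew : beta (qb Q) = (qa Q)%:~R * w by rewrite mulrC mulfVK.
  have w2 : (qa Q)%:~R * w ^+ 2 = - ((qb Q)%:~R * w) - (qc Q)%:~R.
    apply: (mulfI aK); have := beta_sq dQ; rewrite ew => h.
    by transitivity (((qa Q)%:~R * w) ^+ 2); [ring|rewrite h; ring].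
  rewrite ew !(intrD, intrM, rmorphN) /=.
  transitivity (u%:~R * k%:~R * w + u%:~R * m%:~R +
     v%:~R * k%:~R * ((qa Q)%:~R * w ^+ 2) + v%:~R * m%:~R * (qa Q)%:~R * w); first by ring.
  by rewrite w2; ring.
Qed.

(** For the lattice L of Q, both aL and aO are integral and contain a, which is prime to N; so both
    are prime to n. *)
Lemma form_lattice_rayIdeal (Q : binQuadForm) : formsN d N Q ->
  rayIdeals n (form_lattice K Q).
Proof.
move=> [[_ Qpos dQ] gN]; have [N0 nN _] := least_N.
have a0 : 0 < qa Q.
  by have := Qpos 1 0 isT; rewrite /form_eval expr1n expr0n /= !mulr0 !addr0 mulr1.
have aK : ((qa Q)%:~R : K) != 0 by rewrite intrK_eq0; exact: lt0r_neq0.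
have LE := form_latticeE a0 dQ.
have Lm := form_lattice_submodule a0 dQ.
have L1 : form_lattice K Q 1 by apply/LE; exists 0, 1; rewrite mul0r add0r.
have Lnz : nonzero (form_lattice K Q) by exists 1; rewrite ?oner_neq0.
have LO x : form_lattice K Q x -> O ((qa Q)%:~R * x).
  move=> /LE[k [m ->]]; apply/(integral_beta dQ).
  by exists (qa Q * m), k; rewrite mulrDr mulrCA (mulrC (qa Q)%:~R (_ / _)) mulfVK // intrM addrC.
have pi := ideal_principal (intZ K (qa Q)).
have pa : principal (qa Q)%:~R ((qa Q)%:~R : K).
  by exists 1; [exact: int1|rewrite mul1r].
have pnz : nonzero (principal ((qa Q)%:~R : K)) by exists (qa Q)%:~R.
have Bi : isIdeal (idealMul (form_lattice K Q) (principal (qa Q)%:~R)).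
  split; first exact: idealMul_submodule.
  by rewrite idealMul_principal // => _ [x /LO Ox <-].
split; first by split=> //; exists (qa Q)%:~R; split=> //; exact: intZ.
exists (idealMul (form_lattice K Q) (principal (qa Q)%:~R)).
exists (principal (qa Q)%:~R); split=> //.
- by split=> //; exact: nonzero_mul.
- apply: (@coprime_int_ideal _ _ _ (qa Q) N%:Z) => //; last by rewrite /coprimez gN.
  by rewrite -[X in idealMul _ _ X]mul1r; exact: idealMul_mem.
- by apply: (@coprime_int_ideal _ _ _ (qa Q) N%:Z) => //; rewrite /coprimez gN.
Qed.

Lemma beta_mul (a b c : int) : b ^+ 2 - 4 * a * c = d -> forall p q r s : K,
  (p + q * beta b) * (r + s * beta b) =
  (p * r - q * s * (a%:~R * c%:~R)) + (p * s + q * r - q * s * b%:~R) * beta b.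
Proof.
move=> /beta_sq e p q r s.
transitivity (p * r + (p * s + q * r) * beta b + q * s * beta b ^+ 2); first by ring.
by rewrite e; ring.
Qed.

(** Here k is the normalized norm of lam. The last two conclusions say that (k/lam)A is an integral
    ideal whose integers are all divisible by k; it contains k because lam lies in A. *)
Lemma ideal_primitive_element (A : set K) :
  isIdeal A -> nonzero A -> coprime_ideal n A ->
  exists (lam : K) (k : int),
    [/\ A lam /\ lam != 0, ideal_set n (1 - lam), (0 < k) && coprimez k N,
        forall x, A x -> O (k%:~R * x / lam)
      & forall j : int, A (j%:~R * lam / k%:~R) -> (k %| j)%Z].
Proof.
move=> Ai Anz cA.
have [[A0 AD AZ] AO] := Ai; have [nm nO] := ideal_proof n; have [_ nD nZ] := nm.
have [N0 nN _] := least_N.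
have [g [a [b [c [g0 a0 dQ AE]]]]] := ideal_normal_form Ai Anz.
have bmul := beta_mul dQ; have betaE := integral_beta dQ.
set w := beta b in AE bmul betaE.
have [b0 Ab0 nb0] := coprime_ideal1 cA.
have /AE[x0 [y0 eb0]] := Ab0.
(* The norm of g(xa + yw) is g^2 a f(x, y). *)
pose f (x y : int) := a * x ^+ 2 - b * x * y + c * y ^+ 2.
(* The first factor on the right is (ua + vw) times the conjugate of xa + yw, divided by a. *)
have f_mul (x y u v : int) : (f x y)%:~R * (u%:~R * a%:~R + v%:~R * w) =
    ((x * u * a - y * u * b + y * v * c)%:~R + (x * v - y * u)%:~R * w) *
    (x%:~R * a%:~R + y%:~R * w).
  by rewrite bmul /f !(intrD, rmorphN, intrM) /=; ring.
(* h is the norm of A, and D below is the norm 1 - Tr(b0) + N(b0) of 1 - b0. *)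
pose h := g ^+ 2 * a.
pose D := 1 - g * (2 * a * x0 - b * y0) + h * f x0 y0.
have ND : (N %| D)%Z.
  apply: (leastPosInt_dvd least_N).
  (* D is the conjugate of 1 - b0 times 1 - b0, hence lies in n. *)
  have -> : D%:~R = ((1 - g * (x0 * a - y0 * b))%:~R + (g * y0)%:~R * w) * (1 - b0).
    transitivity (((1 - g * (x0 * a - y0 * b))%:~R + (g * y0)%:~R * w) *
      ((1 - g * (x0 * a))%:~R + (- (g * y0))%:~R * w)); last first.
      by congr (_ * _); rewrite eb0 !(intrB, rmorphN, intrM) /=; ring.
    by rewrite bmul /D /h /f !(intrD, rmorphN, intrM) /=; ring.
  apply: nZ => //; apply/betaE; by eexists; eexists.
have [k1 ck1] : exists k1, coprimez (f x0 y0 + k1 * (1 - h * f x0 y0)) N.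
  apply: coprimez_lift; first by rewrite -lt0n.
  have /eqP -> : coprimez (f x0 y0) (1 - h * f x0 y0).
    by apply/coprimezP; exists (h, 1) => /=; ring.
  by rewrite gcd1z.
(* These are the coordinates of b0 + k1(1 - b0)h, where h = g(ga) itself has coordinates (g, 0). *)
pose x1 := x0 + k1 * (g - h * x0); pose y1 := y0 - k1 * h * y0.
have copD (u v : int) : (N %| v)%Z -> coprimez (u + v) N = coprimez u N.
  by case/dvdzP => q ->; rewrite ![coprimez _ N]coprimez_sym /coprimez addrC gcdzMDl.
have cf1 : coprimez (f x1 y1) N.
  have -> : f x1 y1 = f x0 y0 + k1 * (1 - h * f x0 y0) + (k1 ^+ 2 * h - k1) * D.
    by rewrite /D /x1 /y1 /f /h; ring.
  by rewrite copD // dvdz_mull.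
(* A nonzero second coordinate can serve as the modulus in [coprimez_lift], and it also makes lam
   nonzero. *)
have [i y2n0] : exists i : int, y1 + i * N != 0.
  have [y10|?] := eqVneq y1 0; last by exists 0; rewrite mul0r addr0.
  by exists 1; rewrite y10 add0r mul1r -lt0n.
set y2 := y1 + i * N in y2n0.
have [j cxy] : exists j : int, coprimez (x1 + j * N) y2.
  apply: coprimez_lift => //; apply/eqP; rewrite -[_ == 1]/(coprimez _ _).
  (* A prime dividing x1, N and y2 divides y1 too, hence f(x1, y1), against [cf1]. *)
  apply: coprimez_primeP => // p pp; rewrite dvdz_gcd => /andP[px pN].
  rewrite rpredDr ?dvdz_mull // => py.
  have : (p %| gcdz (f x1 y1) N)%Z.
    rewrite dvdz_gcd pN andbT /f expr2 (expr2 y1).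
    by rewrite rpredD ?rpredB // ?dvdz_mull // dvdz_mulr // dvdz_mull.
  rewrite (eqP cf1) dvdzE dvdn1 => /eqP p1.
  by move: (prime_gt1 pp); rewrite (p1 : p = 1%N).
set x2 := x1 + j * N in cxy.
have cf2 : coprimez (f x2 y2) N.
  have -> : f x2 y2 = f x1 y1 + (a * j * (2 * x1 + j * N) - b * (x1 * i + j * y2)
      + c * i * (2 * y1 + i * N)) * N by rewrite /x2 /y2 /f; ring.
  by rewrite copD // dvdz_mull.
have f2_gt0 : 0 < f x2 y2.
  rewrite /f; have -> : a * x2 ^+ 2 - b * x2 * y2 = a * x2 ^+ 2 + (- b) * x2 * y2 by ring.
  apply: (disc_form_gt0 d_lt0 a0); first by rewrite sqrrN.
  by apply: contra_neq y2n0 => -[].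
have gK : (g%:~R : K) != 0 by rewrite intrK_eq0; exact: lt0r_neq0.
have aK : (a%:~R : K) != 0 by rewrite intrK_eq0; exact: lt0r_neq0.
pose lam := g%:~R * (x2%:~R * a%:~R + y2%:~R * w).
have lam0 : lam != 0.
  rewrite mulf_neq0 //; apply: contra_neq y2n0 => e.
  have [_ //] : x2 * a = 0 /\ y2 = 0.
  by apply: (int_lincomb_beta_eq0 (b := b)); rewrite intrM.
have Alam : A lam by apply/AE; exists x2, y2.
have fK : ((f x2 y2)%:~R : K) != 0 by rewrite intrK_eq0; exact: lt0r_neq0.
exists lam, (f x2 y2); split=> //.
(* The first summand is 1 minus the element with coordinates (x1, y1); the second is the shift by a
   multiple of N. *)
- have -> : 1 - lam = (1 - (k1 * h)%:~R) * (1 - b0)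
      + (- (g%:~R * ((j * a)%:~R + i%:~R * w))) * N%:R.
    rewrite /lam eb0 /x2 /y2 /x1 /y1 !(intrD, rmorphN, intrM) /=.
    by rewrite /h !intrM; ring.
  apply: nD; apply: nZ => //.
    by apply: intD; [exact: int1|exact/intN/intZ].
  by apply/intN/intM; [exact: intZ|apply/betaE; eexists; eexists].
- by rewrite f2_gt0.
- move=> _ /AE[u [v ->]]; apply/betaE.
  exists (x2 * u * a - y2 * u * b + y2 * v * c), (x2 * v - y2 * u).
  apply: (mulIf lam0); rewrite mulfVK // /lam ![_ * (g%:~R * _)]mulrCA; congr (_ * _).
  exact: f_mul.
move=> j0 /AE[u [v]].
move/(congr1 ( *%R (f x2 y2)%:~R)); rewrite mulrC mulfVK // /lam => e.
have [/eqP + /eqP] : (j0 * x2 - f x2 y2 * u) * a = 0 /\ j0 * y2 - f x2 y2 * v = 0.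
  apply: (int_lincomb_beta_eq0 (b := b)); apply: (mulfI gK).
  rewrite mulr0; move/eqP: e; rewrite -subr_eq0 => /eqP <-.
  move: (f x2 y2) (x2) (y2) => F X Y.
  by rewrite -/w !(intrB, intrM) /=; ring.
rewrite mulf_eq0 (negPf (lt0r_neq0 a0)) orbF !subr_eq0 => /eqP ju /eqP jv.
(* Since f(x2, y2) divides j0 x2 and j0 y2, it divides j0 = j0(r x2 + s y2). *)
have /coprimezP[[r s] /= rs] := cxy.
apply/dvdzP; exists (r * u + s * v).
by rewrite -[j0]mul1r -rs !mulrDl -!mulrA [x2 * j0]mulrC [y2 * j0]mulrC ju jv; ring.
Qed.

(** The integral ideal L = (k/lam)xA has normal form g[a, beta b] and least positive integer ga = k.
    Dividing by k gives (x/lam)A = [beta b / a, 1], where x and lam are both congruent to 1 mod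
    n. *)
Lemma rayIdeal_form (A : set K) : rayIdeals n A ->
  exists Q : binQuadForm, formsN d N Q /\
    exists2 nu : K, cong_star1 n nu & form_lattice K Q = [set nu * y | y in A].
Proof.
move=> /rayIdeal_integral_scale[x [xs1 xAi xAnz cxA]].
have [lam [k [[Alam lam0] nlam /andP[k0 ckN] kO kprim]]] :=
  ideal_primitive_element xAi xAnz cxA.
have kK : (k%:~R : K) != 0 by rewrite intrK_eq0; exact: lt0r_neq0.
pose L := [set k%:~R / lam * y | y in [set x * y | y in A]].
have Li : isIdeal L.
  split; first by apply: submodule_scale; exact: (proj1 xAi).
  by move=> _ [y xAy <-]; rewrite mulrAC; exact: kO.
have Lk : L k%:~R by exists lam => //; rewrite divfK.
have Lnz : nonzero L by exists k%:~R.
have Ldvd (j : int) : L j%:~R -> (k %| j)%Z.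
  move=> [y xAy ey]; apply: kprim.
  by rewrite -ey [_ * y]mulrAC mulfVK // (mulrC k%:~R) mulfK.
have [g [a [b [c [g0 a0 dQ LE]]]]] := ideal_normal_form Li Lnz.
(* Both sides are positive and divide each other: ga lies in L, and k, being in L, is an integer
   multiple of ga. *)
have ega : g * a = k.
  have kga : (k %| g * a)%Z.
    by apply/Ldvd/LE; exists 1, 0; rewrite mul0r addr0 mul1r intrM.
  have gak : (g * a %| k)%Z.
    have /LE[u [v e]] := Lk.
    have [/eqP + _] : g * (u * a) - k = 0 /\ g * v = 0.
      apply: (int_lincomb_beta_eq0 (b := b)).
      by rewrite intrB [k%:~R in LHS]e !intrM; ring.
    by rewrite subr_eq0 => /eqP <-; apply/dvdzP; exists u; ring.
  have ga0 : 0 < g * a by rewrite mulr_gt0.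
  have /eqP : (absz (g * a) == absz k) by rewrite eqn_dvd; exact/andP.
  by move/(congr1 Posz); rewrite !gez0_abs ?ltW.
exists (BinQuadForm a b c); split.
  split; last first.
    (* The leading coefficient a divides k, which is prime to N. *)
    apply/eqP; rewrite -[gcdz _ _ == 1]/(coprimez _ _) coprimez_sym.
    by apply: coprimez_dvdl ckN; rewrite -ega /= abszM dvdn_mull.
  split=> //=; first exact: (disc_primitive dQ).
  by move=> u v uv0; exact: (disc_form_gt0 d_lt0 a0 dQ).
exists (x / lam).
  apply: cong_star1_mul => //; apply: cong_star1_inv; apply: cong_star1_integral => //.
  exact: (proj2 xAi).
have LQE := @form_latticeE (BinQuadForm a b c) a0 dQ.
have aK : (a%:~R : K) != 0 by rewrite intrK_eq0; exact: lt0r_neq0.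
have gK : (g%:~R : K) != 0 by rewrite intrK_eq0; exact: lt0r_neq0.
apply/seteqP; split=> z.
  move=> /LQE[u [v ->]].
  have [_ [y Ay <-] ey] : L (g%:~R * (v%:~R * a%:~R + u%:~R * beta b)).
    by apply/LE; exists v, u.
  exists y => //; apply: (mulfI kK).
  transitivity (k%:~R / lam * (x * y)); first by ring.
  rewrite ey -ega intrM mulrDr.
  transitivity (g%:~R * (a%:~R / a%:~R) * u%:~R * beta b + g%:~R * a%:~R * v%:~R).
    by rewrite mulfV //; ring.
  by rewrite /=; ring.
move=> [y Ay <-]; apply/LQE.
have /LE[u [v e]] : L (k%:~R / lam * (x * y)) by exists (x * y) => //; exists y.
exists v, u; apply: (mulfI kK).
transitivity (k%:~R / lam * (x * y)); first by ring.
rewrite e -ega intrM /=.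
transitivity (g%:~R * (a%:~R / a%:~R) * v%:~R * beta b + g%:~R * a%:~R * u%:~R).
  by rewrite mulfV //; ring.
by ring.
Qed.

End FormIdeals.

(** * The map to the ray class group *)

Lemma rayClass_surj (C : numClosedFieldType) (K : imagQuadField C)
    (n : integralIdeal K) (z : rayClassGroup n) :
  exists2 A, rayIdeals n A & z = rayClass n A.
Proof.
elim/rayClass_ind: z => a; exists (val a); first exact: rayIdealP.
by rewrite /rayClass valKd.
Qed.

(** The quotient of the two classes is represented by A^-1 (A (nu)) = (nu). *)
Lemma rayClass_scale (C : numClosedFieldType) (K : imagQuadField C)
    (n : integralIdeal K) (A : set K) (nu : K) : rayIdeals n A ->
  rayIdeals n [set nu * y | y in A] -> cong_star1 n nu ->
  rayClass n [set nu * y | y in A] = rayClass n A.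
Proof.
move=> hA hB hnu.
(* On ideals of I_K(n) the default value of [insubd] is not taken. *)
have insubE B (h : rayIdeals n B) : insubd (1%g : rayIdealGroup n) B = mk_rayIdeal h.
  by apply: val_inj; rewrite val_insubd mem_set.
rewrite /rayClass (insubE _ hA) (insubE _ hB); apply/esym/rayClass_eqP/asboolP.
exists nu => //.
set a := mk_rayIdeal hA.
have am := rayIdeal_submodule a.
have -> : val (a^-1 * mk_rayIdeal hB)%g =
    idealMul (val a^-1%g) (idealMul (val a) (principal nu)).
  by rewrite idealMul_principal.
by rewrite idealMulA (rayIdeal_mulV a) idealMul1 //; exact: principal_submodule.
Qed.

Theorem theorem2p2 (C : numClosedFieldType) (K : imagQuadField C) (d : int)
    (n : integralIdeal K) (N : nat)
    (hd : isDiscriminant K d) (hn : nonzero n) (hN : isLeastPosInt n N) :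
  (forall Q : formsN d N, rayIdeals n (form_lattice K (val Q))) /\
  exists phi : formClasses n d N -> rayClassGroup n,
    [/\ forall Q : formsN d N,
          phi (formClass n Q) = rayClass n (form_lattice K (val Q)),
        bijective phi
      & exists (mul : formClasses n d N -> formClasses n d N -> formClasses n d N)
          (one : formClasses n d N) (inv : formClasses n d N -> formClasses n d N),
          [/\ associative mul, left_id one mul, left_inverse one inv mul
            & {morph phi : x y / mul x y >-> (x * y)%g}]].
Proof.
have [d0 [theta [t [n0 [etheta edisc OE]]]]] := integral_basis_sqrt hd.
have ray (Q : formsN d N) : rayIdeals n (form_lattice K (val Q)).
  by apply: (form_lattice_rayIdeal d0 etheta edisc OE hN); exact: set_mem (valP Q).
split=> //.
pose phi (x : formClasses n d N) := rayClass n (form_lattice K (val (repr x))).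
have phiE Q : phi (formClass n Q) = rayClass n (form_lattice K (val Q)).
  have /eqmodP/eqP : (\pi_(formClasses n d N) (repr (formClass n Q)) = formClass n Q)%qT.
    by rewrite reprK.
  by [].
have phi_inj : injective phi.
  (* Equality of the values of [phi] is [ray_equiv] between the chosen representatives. *)
  move=> x y e; rewrite -[x]reprK -[y]reprK; apply/eqmodP; exact/eqP.
have phi_surj z : exists x, phi x = z.
  have [A hA ->] := rayClass_surj z.
  have [Q [hQ [nu hnu eL]]] := rayIdeal_form d0 etheta edisc OE hN hA.
  pose Q' : formsN d N := exist (fun A => A \in formsN d N) Q (mem_set hQ).
  have hL := ray Q'.
  exists (formClass n Q'); rewrite phiE /= eL rayClass_scale //.
  by move: hL; rewrite /= eL.
have [psi psiK] := choice phi_surj.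
have phiK : cancel phi psi by move=> x; apply: phi_inj; rewrite psiK.
exists phi; split=> //; first by exists psi.
(* The group law is transported along [phi] and its inverse. *)
exists (fun x y => psi (phi x * phi y)%g), (psi 1%g), (fun x => psi (phi x)^-1%g).
split=> [x y z|x|x|x y]; rewrite ?psiK ?mulgA ?mul1g ?mulVg //.
Qed.
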